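(* Let $Q$ be a quiver and let $\boldsymbol\alpha$ be a subdimension vector of some dimension vector $\boldsymbol n$ (i.e. $\boldsymbol\alpha\le\boldsymbol n$). Then $\boldsymbol\alpha\le_Q\boldsymbol n$ if and only if both of the following hold: (A) $\langle\boldsymbol\alpha,\boldsymbol n-\boldsymbol\alpha\rangle\ge 0$; (B) $\boldsymbol\beta\le_Q\boldsymbol n$ for every $\boldsymbol\beta\in P_Q(\boldsymbol\alpha)$ with $\boldsymbol\beta\ne\boldsymbol\alpha$.
   Context: A quiver $Q=(Q_0,Q_1)$ has a finite vertex set $Q_0$ and a finite arrow set $Q_1$ (cycles and multiple arrows allowed). A dimension vector is a family $\boldsymbol n=(n_x)_{x\in Q_0}$ of nonnegative integers; $\boldsymbol\alpha\le\boldsymbol n$ means $\alpha_x\le n_x$ for all $x$. The Euler form is $$\langle\boldsymbol\alpha,\boldsymbol\beta\rangle=\sum_{x\in Q_0}\alpha_x\beta_x-\sum_{a\colon x\to y\in Q_1}\alpha_x\beta_y .$$ For a family $\mathcal V=(V_x)$ of finite-dimensional complex vector spaces, a representation of $Q$ on $\mathcal V$ is $v=(v_a)\in\mathcal H_Q(\mathcal V)=\bigoplus_{a\colon x\to y}\mathrm{Hom}(V_x,V_y)$. For a dimension vector $\boldsymbol\beta$, let $\mathrm{Gr}_Q(\boldsymbol\beta,\mathcal V)_v$ be the variety of families $\mathcal S=(S_x)\in\prod_x\mathrm{Gr}(\beta_x,V_x)$ with $v_aS_x\subseteq S_y$ for every arrow $a\colon x\to y$. We write $\boldsymbol\alpha\le_Q\boldsymbol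 n$ ($\boldsymbol\alpha$ is a Schofield subdimension vector of $\boldsymbol n$) if $\boldsymbol\alpha\le\boldsymbol n$ and $\mathrm{Gr}_Q(\boldsymbol\alpha,\mathcal V)_v\neq\emptyset$ for every $v\in\mathcal H_Q(\mathcal V)$, where $\dim V_x=n_x$. $P_Q(\boldsymbol\alpha)$ is the set of dimension vectors $\boldsymbol\beta\le\boldsymbol\alpha$ such that, for a family $\mathcal A$ of vector spaces of dimension vector $\boldsymbol\alpha$, $\mathrm{Gr}_Q(\boldsymbol\beta,\mathcal A)_v$ is a single point for generic $v\in\mathcal H_Q(\mathcal A)$ (i.e. for all $v$ in a nonempty Zariski-open subset). *)

(* Defs.v *)
From HB Require Import structures.
From mathcomp Require Import all_boot all_order all_algebra.
From mathcomp Require Import mpoly.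
Set Implicit Arguments.
Unset Strict Implicit.
Unset Printing Implicit Defensive.
Import GRing.Theory Num.Theory.
Local Open Scope ring_scope.

Record quiver := Quiver {
  vertex : finType;
  arrow : finType;
  src : arrow -> vertex;
  tgt : arrow -> vertex
}.

Notation dimvec Q := {ffun vertex Q -> nat}.

Definition dimvec_le (Q : quiver) (alpha n : dimvec Q) : Prop :=
  forall x, (alpha x <= n x)%N.

(* Truncated at each vertex: this is the difference of dimension vectors only
   when [dimvec_le alpha n]. *)
Definition dimvec_sub (Q : quiver) (n alpha : dimvec Q) : dimvec Q :=
  [ffun x => (n x - alpha x)%N].

Definition euler_form (Q : quiver) (alpha beta : dimvec Q) : int :=
  \sum_(x : vertex Q) (alpha x)%:Z * (beta x)%:Z
  - \sum_(a : arrow Q) (alpha (src a))%:Z * (beta (tgt a))%:Z.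

Section Representations.

Variables (K : fieldType) (Q : quiver).

Definition has_dimvec (V : vertex Q -> vectType K) (n : dimvec Q) : Prop :=
  forall x, \dim {: V x} = n x.

Definition rep (V : vertex Q -> vectType K) : Type :=
  forall a : arrow Q, 'Hom(V (src a), V (tgt a)).

Definition quiver_Gr (beta : dimvec Q) (V : vertex Q -> vectType K) (v : rep V)
    (S : forall x, {vspace V x}) : Prop :=
  (forall x, \dim (S x) = beta x) /\
  (forall a, (v a @: S (src a) <= S (tgt a))%VS).

Definition schofield_le (alpha n : dimvec Q) : Prop :=
  dimvec_le alpha n /\
  forall V : vertex Q -> vectType K, has_dimvec V n ->
    forall v : rep V, exists S, quiver_Gr alpha v S.

(* Linear coordinates on the space of representations: the matrix entries of
   all the [v a] in the bases [vbasis {: V x}]. The Zariski topology defined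
   from them does not depend on the choice of bases. *)
Definition rep_index (V : vertex Q -> vectType K) : finType :=
  {a : arrow Q & ('I_(\dim {: V (src a)}) * 'I_(\dim {: V (tgt a)}))%type}.

Definition rep_entry (V : vertex Q -> vectType K) (v : rep V)
    (e : rep_index V) : K :=
  let: existT a (i, j) := e in
  coord (vbasis {: V (tgt a)}) j (v a (vbasis {: V (src a)})`_i).

Definition rep_eval (V : vertex Q -> vectType K)
    (p : {mpoly K[#|rep_index V|]}) (v : rep V) : K :=
  p.@[fun k => rep_entry v (enum_val k)].

Definition zariski_open (V : vertex Q -> vectType K) (U : rep V -> Prop) : Prop :=
  exists F : {mpoly K[#|rep_index V|]} -> Prop,
    forall v, U v <-> exists2 p, F p & rep_eval p v != 0.

Definition generically (V : vertex Q -> vectType K) (P : rep V -> Prop) : Prop :=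
  exists U : rep V -> Prop,
    [/\ zariski_open U, exists v, U v & forall v, U v -> P v].

Definition quiver_Gr_is_point (beta : dimvec Q) (V : vertex Q -> vectType K)
    (v : rep V) : Prop :=
  exists S, quiver_Gr beta v S /\
    forall S', quiver_Gr beta v S' -> forall x, S' x = S x.

Definition in_P (alpha beta : dimvec Q) : Prop :=
  dimvec_le beta alpha /\
  forall A : vertex Q -> vectType K, has_dimvec A alpha ->
    generically (fun v : rep A => quiver_Gr_is_point beta v).

End Representations.

(* Main.v *)
(* Write gamma = n - alpha. For representations u of dimension alpha and w of
   dimension gamma, the map phi |-> (u_a phi - phi w_a)_a has kernel Hom(u, w) and
   cokernel Ext(u, w), so dim Hom - dim Ext = <alpha, gamma>.
   Having a beta-dimensional subrepresentation is a constructible condition, and it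
   is closed because Grassmannians are compact; hence it holds always or fails
   generically.
   If Ext(u, w) = 0 for some (u, w), then alpha <=_Q n. Otherwise, by counting
   dimensions of the varieties of triples (u, w, phi) with phi of fixed rank, the
   kernel of a generic phi has a dimension vector beta <=_Q alpha for which the
   generic Ext from beta to gamma is again nonzero; descending, one reaches some
   beta <=_Q alpha with <beta, gamma> < 0. In a generic u, consider the
   subrepresentations minimizing <_, gamma>: they are closed under sums and
   intersections, so the largest one, T of dimension beta, is the only one of its
   dimension, that is, beta is in P_Q(alpha). Moreover Hom(T, u / T) = 0, whence
   <beta, alpha - beta> <= 0 and <beta, n - beta> <= <beta, gamma> < 0. So beta is
   not <=_Q n, contradicting (A) if beta = alpha and (B) otherwise. *)
Require Import Defs.
From HB Require Import structures.
From mathcomp Require Import all_boot all_order all_algebra all_field.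
From mathcomp Require Import perm zify ring.
From mathcomp Require Import boolp classical_sets functions reals topology normedtype sequences.
From mathcomp Require Import complex.
From mathcomp Require mpoly.
Set Implicit Arguments.
Unset Strict Implicit.
Unset Printing Implicit Defensive.
Import Order.TTheory GRing.Theory Num.Theory.
Local Open Scope ring_scope.

(** * Polynomial functions and thin sets *)

(** Dimension theory is replaced by counting parameters: the image of a rational map with fewer
    parameters than target coordinates lies in the zero set of a nonzero polynomial, and generic
    choices avoid finitely many such sets. The obstacle is that Hom(u, w) varies with (u, w), so the
    triples (u, w, phi) do not form an affine space. With h the generic dimension of Hom(u, w), one
    fixes h linear forms on the families phi; for generic (u, w) their values determine phi in
    Hom(u, w), and all values occur. So (u, w) and h numbers serve as coordinates, in which the
    triples with phi of given rank can be counted. With d the rank vector of a generic phi and beta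
    = alpha - d, the count gives <beta, gamma - d> < 0. As d <=_Q gamma, every w has a
    subrepresentation w' of dimension d, and Hom(u', w') inside Hom(u', w) is too large for Ext(u',
    w) to vanish, for every u' of dimension beta. This drives the descent. The topology of the
    complex numbers serves only to prove closedness; the rest is over any [numClosedFieldType] that
    has this property. *)

Inductive polyfun (K : fieldType) (I : Type) : ((I -> K) -> K) -> Prop :=
| polyfun_const c : polyfun (fun=> c)
| polyfun_coord i : polyfun (fun x => x i)
| polyfun_add f g : polyfun f -> polyfun g -> polyfun (fun x => f x + g x)
| polyfun_mul f g : polyfun f -> polyfun g -> polyfun (fun x => f x * g x).

Definition pmx (K : fieldType) (I : Type) m n (F : (I -> K) -> 'M[K]_(m, n)) :=
  forall i j, polyfun (fun x => F x i j).

Section Polyfun.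
Variable K : fieldType.
Implicit Types I J : Type.

Lemma eq_polyfun I (f g : (I -> K) -> K) : f =1 g -> polyfun f -> polyfun g.
Proof. by move=> /funext->. Qed.

Lemma polyfun_opp I (f : (I -> K) -> K) : polyfun f -> polyfun (fun x => - f x).
Proof.
move=> pf; apply: (eq_polyfun (f := fun x => -1 * f x)) => [x|].
  by rewrite mulN1r.
by apply: polyfun_mul => //; apply: polyfun_const.
Qed.

Lemma polyfun_sub I (f g : (I -> K) -> K) :
  polyfun f -> polyfun g -> polyfun (fun x => f x - g x).
Proof. by move=> pf pg; apply: polyfun_add => //; apply: polyfun_opp. Qed.

Lemma polyfun_sum I T (r : seq T) (P : pred T) (F : T -> (I -> K) -> K) :
  (forall t, P t -> polyfun (F t)) -> polyfun (fun x => \sum_(t <- r | P t) F t x).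
Proof.
move=> pF; elim: r => [|t r IH].
  by apply: eq_polyfun (polyfun_const I 0) => x; rewrite big_nil.
case Pt: (P t).
  apply: eq_polyfun (polyfun_add (pF t Pt) IH) => x; by rewrite big_cons Pt.
by apply: eq_polyfun IH => x; rewrite big_cons Pt.
Qed.

Lemma polyfun_prod I T (r : seq T) (P : pred T) (F : T -> (I -> K) -> K) :
  (forall t, P t -> polyfun (F t)) -> polyfun (fun x => \prod_(t <- r | P t) F t x).
Proof.
move=> pF; elim: r => [|t r IH].
  by apply: eq_polyfun (polyfun_const I 1) => x; rewrite big_nil.
case Pt: (P t).
  apply: eq_polyfun (polyfun_mul (pF t Pt) IH) => x; by rewrite big_cons Pt.
by apply: eq_polyfun IH => x; rewrite big_cons Pt.
Qed.

Lemma polyfun_comp I J (f : (J -> K) -> K) (h : J -> (I -> K) -> K) :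
  polyfun f -> (forall j, polyfun (h j)) ->
  polyfun (fun x => f (fun j => h j x)).
Proof.
move=> pf ph; elim: pf => [c|j|g k _ IH1 _ IH2|g k _ IH1 _ IH2].
- exact: polyfun_const.
- exact: ph.
- exact: polyfun_add.
- exact: polyfun_mul.
Qed.

Lemma polyfun_reindex I J (f : (J -> K) -> K) (s : J -> I) :
  polyfun f -> polyfun (fun x => f (fun j => x (s j))).
Proof. by move=> pf; apply: polyfun_comp pf _ => j; apply: polyfun_coord. Qed.

Lemma polyfun_curve I (f : (I -> K) -> K) (c : I -> {poly K}) :
  polyfun f -> exists p : {poly K}, forall t, f (fun i => (c i).[t]) = p.[t].
Proof.
elim=> [a|i|g h _ [p Hp] _ [q Hq]|g h _ [p Hp] _ [q Hq]].
- by exists a%:P => t; rewrite hornerC.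
- by exists (c i).
- by exists (p + q) => t; rewrite hornerD Hp Hq.
- by exists (p * q) => t; rewrite hornerM Hp Hq.
Qed.

Lemma pmx_const I m n (A : 'M[K]_(m, n)) : pmx (fun _ : I -> K => A).
Proof. by move=> i j; apply: polyfun_const. Qed.

Lemma pmx_add I m n (F G : (I -> K) -> 'M[K]_(m, n)) :
  pmx F -> pmx G -> pmx (fun x => F x + G x).
Proof.
move=> pF pG i j; apply: eq_polyfun (polyfun_add (pF i j) (pG i j)) => x.
by rewrite mxE.
Qed.

Lemma pmx_opp I m n (F : (I -> K) -> 'M[K]_(m, n)) :
  pmx F -> pmx (fun x => - F x).
Proof.
by move=> pF i j; apply: eq_polyfun (polyfun_opp (pF i j)) => x; rewrite mxE.
Qed.

Lemma pmx_sub I m n (F G : (I -> K) -> 'M[K]_(m, n)) :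
  pmx F -> pmx G -> pmx (fun x => F x - G x).
Proof. by move=> pF pG; apply: pmx_add => //; apply: pmx_opp. Qed.

Lemma pmx_mul I m n p (F : (I -> K) -> 'M[K]_(m, n)) (G : (I -> K) -> 'M_(n, p)) :
  pmx F -> pmx G -> pmx (fun x => F x *m G x).
Proof.
move=> pF pG i j.
apply: (eq_polyfun (f := fun x => \sum_k F x i k * G x k j)) => [x|].
  by rewrite mxE.
by apply: polyfun_sum => k _; apply: polyfun_mul.
Qed.

Lemma pmx_scale I m n (f : (I -> K) -> K) (F : (I -> K) -> 'M[K]_(m, n)) :
  polyfun f -> pmx F -> pmx (fun x => f x *: F x).
Proof.
move=> pf pF i j; apply: eq_polyfun (polyfun_mul pf (pF i j)) => x.
by rewrite mxE.
Qed.

Lemma pmx_row I m n1 n2 (F : (I -> K) -> 'M[K]_(m, n1)) (G : (I -> K) -> 'M_(m, n2)) :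
  pmx F -> pmx G -> pmx (fun x => row_mx (F x) (G x)).
Proof.
move=> pF pG i j; case: (split_ordP j) => k ->.
  by apply: eq_polyfun (pF i k) => x; rewrite row_mxEl.
by apply: eq_polyfun (pG i k) => x; rewrite row_mxEr.
Qed.

Lemma pmx_col I m1 m2 n (F : (I -> K) -> 'M[K]_(m1, n)) (G : (I -> K) -> 'M_(m2, n)) :
  pmx F -> pmx G -> pmx (fun x => col_mx (F x) (G x)).
Proof.
move=> pF pG i j; case: (split_ordP i) => k ->.
  by apply: eq_polyfun (pF k j) => x; rewrite col_mxEu.
by apply: eq_polyfun (pG k j) => x; rewrite col_mxEd.
Qed.

Lemma polyfun_det I n (F : (I -> K) -> 'M[K]_n) :
  pmx F -> polyfun (fun x => \det (F x)).
Proof.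
move=> pF; rewrite /determinant; apply: polyfun_sum => s _.
apply: polyfun_mul; first exact: polyfun_const.
by apply: polyfun_prod => i _; apply: pF.
Qed.

Lemma pmx_adj I n (F : (I -> K) -> 'M[K]_n) :
  pmx F -> pmx (fun x => \adj (F x)).
Proof.
move=> pF i j.
apply: (eq_polyfun (f := fun x => (-1) ^+ (j + i) * \det (row' j (col' i (F x))))).
  by move=> x; rewrite mxE.
apply: polyfun_mul; first exact: polyfun_const.
apply: polyfun_det => a b; apply: eq_polyfun (pF (lift j a) (lift i b)) => x.
by rewrite !mxE.
Qed.

End Polyfun.

(** Failure of Zariski density, without a topology. The polynomial has to be nonzero as a
    function. *)
Definition thin (K : fieldType) (I : Type) (X : (I -> K) -> Prop) :=
  exists f, [/\ polyfun f, exists x, f x != 0 & forall x, X x -> f x = 0].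

Section Thin.
Variable K : numFieldType.

(** The points 1/(k+1) tend to 0, so the lemma yields not only a nonroot but also sequences of good
    points converging to a given one. *)
Lemma finitely_many_roots (p : {poly K}) : p != 0 ->
  exists m, forall k, (m <= k)%N -> p.[k.+1%:R^-1] != 0.
Proof.
move=> p0; set s := fun k : nat => k.+1%:R^-1 : K.
have inj_s : injective s.
  move=> i j /invr_inj /eqP; rewrite eqr_nat => /eqP[] //.
suff [m Hm] : exists m, forall k, (m <= k)%N -> ~~ root p (s k).
  by exists m => k /Hm.
apply: contrapT => H.
have G m : exists k, (m <= k)%N /\ root p (s k).
  apply: contrapT => H'; apply: H; exists m => k mk.
  by apply/negP => rk; apply: H'; exists k.
have [l [sz ul al]] : exists l : seq nat,
    [/\ size l = size p, uniq l & all (fun k => root p (s k)) l].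
  elim: (size p) => [|n [l [sz ul al]]]; first by exists [::].
  have [k [mk rk]] := G (\max_(i <- l) i).+1.
  exists (k :: l); rewrite /= sz ul al rk; split => //; rewrite andbT.
  apply/negP => kl; move: mk; rewrite ltnNge.
  by rewrite (leq_bigmax_seq _ kl).
have := max_poly_roots p0 (rs := [seq s k | k <- l]).
rewrite all_map al (map_inj_uniq inj_s) ul size_map sz ltnn => /(_ isT isT) //.
Qed.

Lemma poly_nonroot (p : {poly K}) : p != 0 -> exists2 t, t != 0 & p.[t] != 0.
Proof.
move=> /finitely_many_roots[m Hm]; exists (m.+1%:R^-1); last exact: Hm.
by rewrite invr_eq0 pnatr_eq0.
Qed.

Variable I : Type.
Implicit Types (f g : (I -> K) -> K) (X Y : (I -> K) -> Prop).

Lemma polyfun_line f (x y : I -> K) : polyfun f ->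
  exists p : {poly K}, forall t, f (fun i => x i + t * y i) = p.[t].
Proof.
move=> /(polyfun_curve (fun i => (x i)%:P + 'X * (y i)%:P))[p Hp].
by exists p => t; rewrite -Hp; congr f; apply: funext => i; rewrite !hornerE.
Qed.

(** On the line from x to y both functions become polynomials in one variable, nonzero at 0 and at 1
    respectively, and the product of these has a nonroot. *)
Lemma polyfun_mul_neq0 f g : polyfun f -> polyfun g ->
  (exists x, f x != 0) -> (exists x, g x != 0) -> exists x, f x * g x != 0.
Proof.
move=> pf pg [x fx] [y gy].
have [p Hp] := polyfun_line x (fun i => y i - x i) pf.
have [q Hq] := polyfun_line x (fun i => y i - x i) pg.
have p0 : p != 0.
  apply: contra_neq fx => p0; rewrite -[RHS](horner0 0) -p0 -Hp.
  by congr f; apply: funext => i; rewrite mul0r addr0.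
have q0 : q != 0.
  apply: contra_neq gy => q0; rewrite -[RHS](horner0 1) -q0 -Hq.
  by congr g; apply: funext => i; rewrite mul1r subrKC.
have [t _ Ht] := poly_nonroot (mulf_neq0 p0 q0).
by exists (fun i => x i + t * (y i - x i)); rewrite Hp Hq -hornerM.
Qed.

Lemma polyfun_prod_neq0 T (r : seq T) (F : T -> (I -> K) -> K) :
  (forall t, polyfun (F t)) -> (forall t, exists x, F t x != 0) ->
  exists x, \prod_(t <- r) F t x != 0.
Proof.
move=> pF nF; elim: r => [|t r [x IH]].
  by exists (fun=> 0); rewrite big_nil oner_eq0.
have [] := @polyfun_mul_neq0 (F t) (fun x => \prod_(t <- r) F t x).
- exact: pF.
- by apply: polyfun_prod.
- exact: nF.
- by exists x.
by move=> y Hy; exists y; rewrite big_cons.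
Qed.

Lemma thin_sub X Y : (forall x, X x -> Y x) -> thin Y -> thin X.
Proof. by move=> XY [f [pf nf fY]]; exists f; split => // x /XY/fY. Qed.

Lemma thin_exists (T : finType) (X : T -> (I -> K) -> Prop) :
  (forall t, thin (X t)) -> thin (fun x => exists t, X t x).
Proof.
move=> /choice[f Hf]; exists (fun x => \prod_t f t x); split.
- by apply: polyfun_prod => t _; case: (Hf t).
- by apply: polyfun_prod_neq0 => t; case: (Hf t).
- move=> x [t Xt]; case: (Hf t) => _ _ /(_ x Xt) fx0.
  by rewrite (bigD1 t) //= fx0 mul0r.
Qed.

Lemma thin_or X Y : thin X -> thin Y -> thin (fun x => X x \/ Y x).
Proof.
move=> tX tY; apply: (thin_sub (Y := fun x => exists b : bool, if b then X x else Y x)).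
  by move=> x [Xx|Yx]; [exists true|exists false].
by apply: thin_exists => -[].
Qed.

Lemma thin_avoid X g : thin X -> polyfun g -> (exists x, g x != 0) ->
  exists2 x, g x != 0 & ~ X x.
Proof.
move=> [f [pf nf fX]] pg ng.
have [x] := polyfun_mul_neq0 pf pg nf ng.
by rewrite mulf_eq0 negb_or => /andP[fx gx]; exists x => // /fX/eqP; apply/negP.
Qed.

Lemma thin_zero f : polyfun f -> (exists x, f x != 0) -> thin (fun x => f x = 0).
Proof. by move=> pf nf; exists f. Qed.

End Thin.

(** A cylinder over a thin set is thin. The partial inverse [s'] lifts a point of the base, with 0
    in the other coordinates. *)
Lemma thin_reindex (K : numFieldType) (I J : Type) (s : J -> I) (s' : I -> option J)
    (X : (J -> K) -> Prop) :
  (forall j, s' (s j) = Some j) ->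
  thin X -> thin (fun x : I -> K => X (fun j => x (s j))).
Proof.
move=> sK [f [pf [y fy] fX]]; exists (fun x => f (fun j => x (s j))); split.
- exact: polyfun_reindex.
- exists (fun i => if s' i is Some j then y j else 0).
  by rewrite (_ : (fun j => _) = y) //; apply: funext => j; rewrite sK.
- by move=> x /fX.
Qed.

(** * Images of polynomial maps with fewer parameters *)

Inductive degree_bound (K : fieldType) (I : finType) (d : nat) :
    ((I -> K) -> K) -> Prop :=
| degree_bound_mono c (e : I -> nat) :
    (forall i, (e i <= d)%N) -> degree_bound d (fun x => c * \prod_i x i ^+ e i)
| degree_bound_add f g :
    degree_bound d f -> degree_bound d g -> degree_bound d (fun x => f x + g x).

Section DegreeBound.
Variables (K : fieldType) (I : finType).
Implicit Types (f g : (I -> K) -> K).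

Lemma eq_degree_bound d f g : f =1 g -> degree_bound d f -> degree_bound d g.
Proof. by move=> /funext->. Qed.

Lemma degree_bound_leq d d' f :
  (d <= d')%N -> degree_bound d f -> degree_bound d' f.
Proof.
move=> dd'; elim=> [c e ed|g h _ IH1 _ IH2].
  by apply: degree_bound_mono => i; apply: leq_trans (ed i) dd'.
exact: degree_bound_add.
Qed.

Lemma degree_bound_const c : degree_bound 0 (fun _ : I -> K => c).
Proof.
apply: eq_degree_bound (degree_bound_mono c (e := fun=> 0%N) _) => // x.
by rewrite big1 ?mulr1.
Qed.

Lemma degree_bound_mul d d' f g : degree_bound d f -> degree_bound d' g ->
  degree_bound (d + d') (fun x => f x * g x).
Proof.
move=> Hf Hg; elim: Hf => [c e ed|f1 f2 _ IH1 _ IH2]; last first.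
  by apply: eq_degree_bound (degree_bound_add IH1 IH2) => x; rewrite mulrDl.
elim: Hg => [c' e' ed'|g1 g2 _ IH1 _ IH2]; last first.
  by apply: eq_degree_bound (degree_bound_add IH1 IH2) => x; rewrite mulrDr.
apply: eq_degree_bound (degree_bound_mono (c * c') (e := fun i => (e i + e' i)%N) _).
  move=> x; rewrite mulrACA -big_split /=; congr (_ * _).
  by apply: eq_bigr => i _; rewrite exprD.
by move=> i; apply: leq_add.
Qed.

Lemma degree_bound_prod d (T : Type) (r : seq T) (P : pred T) (F : T -> (I -> K) -> K) :
  (forall t, degree_bound d (F t)) ->
  degree_bound (size r * d)%N (fun x => \prod_(t <- r | P t) F t x).
Proof.
move=> HF; elim: r => [|t r IH].
  by apply: eq_degree_bound (degree_bound_const 1) => x; rewrite big_nil.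
case Pt: (P t).
  apply: eq_degree_bound (degree_bound_mul (HF t) IH) => x.
  by rewrite big_cons Pt.
apply: (degree_bound_leq (d := size r * d)); first by rewrite leq_mul2r leqnSn orbT.
by apply: eq_degree_bound IH => x; rewrite big_cons Pt.
Qed.

Lemma polyfun_degree_bound f : polyfun f -> exists d, degree_bound d f.
Proof.
elim=> [c|i|g h _ [d Hd] _ [d' Hd']|g h _ [d Hd] _ [d' Hd']].
- by exists 0%N; apply: degree_bound_const.
- exists 1%N.
  apply: eq_degree_bound (degree_bound_mono 1 (e := fun j => (j == i : nat)) _).
    move=> x; rewrite mul1r (bigD1 i) //= eqxx expr1 big1 ?mulr1 // => j /negPf->.
    by rewrite expr0.
  by move=> j; apply: leq_b1.
- exists (maxn d d'); apply: degree_bound_add.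
    by apply: degree_bound_leq Hd; apply: leq_maxl.
  by apply: degree_bound_leq Hd'; apply: leq_maxr.
- by exists (d + d')%N; apply: degree_bound_mul.
Qed.

(** Bounding the degree in each variable separately leaves a box of [d.+1 ^ #|I|] monomials, which
    is the dimension bound behind the linear relation below. *)
Lemma degree_bound_span d f : degree_bound d f ->
  exists c : {ffun I -> 'I_d.+1} -> K,
    forall x, f x = \sum_e c e * \prod_i x i ^+ e i.
Proof.
elim=> [c e ed|g h _ [c Hc] _ [c' Hc']].
  exists (fun e' => if e' == [ffun i => inord (e i)] then c else 0) => x.
  rewrite (bigD1 [ffun i => inord (e i)]) //= eqxx [X in _ + X]big1 ?addr0.
    by congr (_ * _); apply: eq_bigr => i _; rewrite ffunE inordK // ltnS.
  by move=> e' /negPf->; rewrite mul0r.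
exists (fun e => c e + c' e) => x; rewrite Hc Hc' -big_split /=.
by apply: eq_bigr => e _; rewrite mulrDl.
Qed.

Lemma degree_bound_dependent d (T : finType) (F : T -> (I -> K) -> K) :
  (forall t, degree_bound d (F t)) -> (d.+1 ^ #|I| < #|T|)%N ->
  exists c : T -> K, (exists t, c t != 0) /\ forall x, \sum_t c t * F t x = 0.
Proof.
move=> HF; have [M HM] := choice (fun t => degree_bound_span (HF t)).
pose E : finType := ({ffun I -> 'I_d.+1})%type.
have -> : (d.+1 ^ #|I| = #|E|)%N by rewrite card_ffun card_ord.
move=> ET.
pose A := \matrix_(i < #|T|, j < #|E|) M (enum_val i) (enum_val j).
have : kermx A != 0.
  rewrite -mxrank_eq0 mxrank_ker subn_eq0 -ltnNge.
  exact: leq_ltn_trans (rank_leq_col A) ET.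
case/rowV0Pn=> v /sub_kermxP vA v0.
exists (fun t => v 0 (enum_rank t)); split.
  by case/rV0Pn: v0 => i vi; exists (enum_val i); rewrite enum_valK.
move=> x; under eq_bigr do rewrite HM mulr_sumr.
rewrite exchange_big big1 //= => e _.
under eq_bigr do rewrite mulrA; rewrite -mulr_suml.
suff -> : \sum_t v 0 (enum_rank t) * M t e = (v *m A) 0 (enum_rank e).
  by rewrite vA mxE mul0r.
rewrite mxE (reindex enum_rank) /=; last first.
  by apply: onW_bij; apply: enum_rank_bij.
by apply: eq_bigr => t _; rewrite mxE !enum_rankK.
Qed.

End DegreeBound.

Section Image.
Variable K : numFieldType.

(* Lagrange products for a grid with D^#|J| nodes are linearly independent, but
   pulled back along the map they are polynomials whose degree in each of the
   #|I| variables is O(D), hence lie in a space of dimension O(D^#|I|). *)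
Lemma image_thin (I J : finType) (p : J -> (I -> K) -> K) (q : (I -> K) -> K) :
  (#|I| < #|J|)%N -> (forall j, polyfun (p j)) -> polyfun q ->
  thin (fun y => exists2 x, q x != 0 & forall j, y j * q x = p j x).
Proof.
move=> IJ pp pq.
have [e [He Heq]] : exists e, (forall j, degree_bound e (p j)) /\ degree_bound e q.
  have [m Hm] := choice (fun j => polyfun_degree_bound (pp j)).
  have [d Hd] := polyfun_degree_bound pq.
  exists (maxn d (\max_j m j)); split => [j|].
    apply: degree_bound_leq (Hm j); rewrite leq_max.
    by apply/orP; right; apply: leq_bigmax.
  by apply: degree_bound_leq Hd; apply: leq_maxl.
(* [C] is chosen so that the degree bound plus one is at most D * C, and [D] exceeds C ^ #|I|; then
   (D * C) ^ #|I| < D ^ (#|I| + 1) <= D ^ #|J|. *)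
pose C := (#|J| * e).+1; pose D := (C ^ #|I|).+1.
pose L (g : {ffun J -> 'I_D}) (y : J -> K) :=
  \prod_j \prod_(c < D | c != g j) (y j - c%:R).
(* The pullback of [L g] with denominators cleared: each of the D - 1 factors for each j absorbs one
   [q x]. *)
pose L' (g : {ffun J -> 'I_D}) (x : I -> K) :=
  \prod_j \prod_(c < D | c != g j) (p j x - c%:R * q x).
have polyL g : polyfun (L g).
  apply: polyfun_prod => j _; apply: polyfun_prod => c _.
  by apply: polyfun_sub; [apply: polyfun_coord|apply: polyfun_const].
have HL' g : degree_bound (#|J| * (D * e)) (L' g).
  rewrite cardE enumT.
  apply: (@degree_bound_prod _ _ _ _ _ xpredT (fun j x =>
     \prod_(c < D | c != g j) (p j x - c%:R * q x))) => j.
  rewrite -[X in degree_bound (X * e) _]card_ord cardE enumT.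
  apply: (@degree_bound_prod _ _ _ _ _ _ (fun (c : 'I_D) x => p j x - c%:R * q x)) => c.
  apply: degree_bound_add; first exact: He.
  apply: eq_degree_bound (degree_bound_mul (degree_bound_const I (- c%:R)) Heq).
  by move=> x; rewrite mulNr.
have card_lt : ((#|J| * (D * e)).+1 ^ #|I| < #|{ffun J -> 'I_D}|)%N.
  rewrite card_ffun card_ord.
  apply: (@leq_ltn_trans ((D * C) ^ #|I|)).
    case: #|I| => // k; rewrite leq_exp2r // mulnCA mulnS addnC -addn1 leq_add2l //.
  rewrite expnMn; apply: (@leq_trans (D ^ #|I|.+1)); last by rewrite leq_pexp2l.
  by rewrite expnS mulnC ltn_pmul2r // expn_gt0.
have [c [[g cg] Hc]] := degree_bound_dependent HL' card_lt.
exists (fun y => \sum_g c g * L g y); split.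
- apply: polyfun_sum => h _; apply: polyfun_mul => //; exact: polyfun_const.
- exists (fun j => (g j)%:R); rewrite (bigD1 g) //= [X in _ + X]big1 ?addr0.
    rewrite mulf_neq0 //; apply/prodf_neq0 => j _; apply/prodf_neq0 => k kg.
    by rewrite subr_eq0 eqr_nat eq_sym.
  move=> h hg; have [j jP] : exists j, h j != g j.
    by apply/existsP; rewrite -negb_forall; apply: contra hg => /eqfunP/ffunP/eqP.
  rewrite /L (bigD1 j) //= (bigD1 (g j)) 1?eq_sym //=.
  by rewrite subrr !mul0r mulr0.
- move=> y [x qx Hy].
  have E h : L' h x = q x ^+ (D.-1 * #|J|) * L h y.
    rewrite /L /L' exprM -prodr_const -big_split /=; apply: eq_bigr => j _.
    under eq_bigr do rewrite -Hy -mulrBl mulrC.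
    rewrite big_split /=; congr (_ * _).
    by rewrite prodr_const; congr (_ ^+ _); rewrite cardC1 card_ord.
  have := Hc x; under eq_bigr do rewrite E mulrCA; rewrite -mulr_sumr => /eqP.
  by rewrite mulf_eq0 expf_eq0 (negPf qx) andbF => /eqP.
Qed.

End Image.

(** * Generic truth value of existential polynomial conditions *)

Definition joint (K I Z : Type) (v : I -> K) (z : Z -> K) (s : I + Z) : K :=
  match s with inl i => v i | inr k => z k end.

Section Dichotomy.
Variable K : numClosedFieldType.

Lemma polyfun_term (I : Type) (idx : I -> nat) (f : (I -> K) -> K) : polyfun f ->
  exists t : GRing.term K, GRing.rterm t /\
    forall e, GRing.eval e t = f (fun i => nth 0 e (idx i)).
Proof.
elim=> [c|i|g h _ [t [rt Ht]] _ [u [ru Hu]]|g h _ [t [rt Ht]] _ [u [ru Hu]]].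
- by exists (GRing.Const c).
- by exists (GRing.Var _ (idx i)).
- by exists (GRing.Add t u); rewrite /= rt ru; split=> // e; rewrite Ht Hu.
- by exists (GRing.Mul t u); rewrite /= rt ru; split=> // e; rewrite Ht Hu.
Qed.

Section Environment.
Variable I : finType.
Definition env (v : I -> K) : seq K := [seq v i | i <- enum I].

Lemma size_env v : size (env v) = #|I|.
Proof. by rewrite size_map -cardE. Qed.

Lemma nth_env v k (i0 : I) : nth 0 (env v) k =
  if (k < #|I|)%N then v (nth i0 (enum I) k) else 0.
Proof.
case: ltnP => kI; first by rewrite (nth_map i0) -?cardE.
by rewrite nth_default // size_map -cardE.
Qed.

Lemma polyfun_rterm (t : GRing.term K) :
  GRing.rterm t -> polyfun (fun v => GRing.eval (env v) t).
Proof.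
elim: t => //=.
- move=> k _; case: (pickP (@predT I)) => [i0 _|I0].
    case: (ltnP k #|I|) => kI.
      apply: eq_polyfun (polyfun_coord K (nth i0 (enum I) k)) => v.
      by rewrite (nth_env v k i0) kI.
    apply: eq_polyfun (polyfun_const I 0) => v.
    by rewrite (nth_env v k i0) ltnNge kI.
  apply: eq_polyfun (polyfun_const I 0) => v.
  by rewrite /env (_ : enum I = [::]) ?nth_nil //; apply/eqP; rewrite -size_eq0 -cardE eq_card0.
- by move=> c _; exact: polyfun_const.
- by move=> n _; exact: polyfun_const.
- by move=> t IHt u IHu /andP[rt ru]; apply: polyfun_add; auto.
- by move=> t IHt rt; apply: polyfun_opp; auto.
- move=> t IHt n rt.
  apply: eq_polyfun (polyfun_mul (polyfun_const I n%:R) (IHt rt)) => v.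
  by rewrite mulr_natl.
- by move=> t IHt u IHu /andP[rt ru]; apply: polyfun_mul; auto.
- move=> t IHt n rt; elim: n => [|n IHn]; first exact: polyfun_const.
  by apply: eq_polyfun (polyfun_mul (IHt rt) IHn) => v; rewrite exprS.
Qed.

(** An equation either holds identically or fails off the zero set of a nonzero polynomial, and
    connectives preserve the existence of a generic truth value because finite unions of thin sets
    are thin. *)
Lemma qf_generic (phi : GRing.formula K) : GRing.qf_form phi -> GRing.rformula phi ->
  exists b, thin (fun v => GRing.qf_eval (env v) phi <> b).
Proof.
have thin0 (X : (I -> K) -> Prop) : (forall v, ~ X v) -> thin X.
  move=> X0; exists (fun=> 1); split; first exact: polyfun_const.
    by exists (fun=> 0); rewrite oner_eq0.
  by move=> v /X0.
elim: phi => //=.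
- by move=> b _ _; exists b; apply: thin0 => v; apply.
- move=> t u _ /andP[/polyfun_rterm pt /polyfun_rterm pu].
  have pf := polyfun_sub pt pu.
  have [nz|z] := EM (exists v, GRing.eval (env v) t - GRing.eval (env v) u != 0).
    exists false; apply: thin_sub (thin_zero pf nz) => v /=.
    by case: eqP => // ->; rewrite subrr.
  exists true; apply: thin0 => v; apply; apply/eqP.
  by apply: contrapT => /eqP tu; apply: z; exists v; rewrite subr_eq0.
- move=> f IHf g IHg /andP[qf qg] /andP[rf rg].
  have [b Hb] := IHf qf rf; have [c Hc] := IHg qg rg.
  exists (b && c); apply: thin_sub (thin_or Hb Hc) => v H.
  by apply: contrapT => /not_orP[/contrapT fb /contrapT gc]; apply: H; rewrite fb gc.
- move=> f IHf g IHg /andP[qf qg] /andP[rf rg].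
  have [b Hb] := IHf qf rf; have [c Hc] := IHg qg rg.
  exists (b || c); apply: thin_sub (thin_or Hb Hc) => v H.
  by apply: contrapT => /not_orP[/contrapT fb /contrapT gc]; apply: H; rewrite fb gc.
- move=> f IHf g IHg /andP[qf qg] /andP[rf rg].
  have [b Hb] := IHf qf rf; have [c Hc] := IHg qg rg.
  exists (b ==> c); apply: thin_sub (thin_or Hb Hc) => v H.
  by apply: contrapT => /not_orP[/contrapT fb /contrapT gc]; apply: H; rewrite fb gc.
- move=> f IHf qf rf; have [b Hb] := IHf qf rf.
  by exists (~~ b); apply: thin_sub Hb => v nb fb; apply: nb; rewrite fb.
Qed.

End Environment.

(* Chevalley's theorem, through quantifier elimination for algebraically closed
   fields. *)
Lemma generic_dichotomy (I Z E : finType) (f : E -> (I + Z -> K) -> K) :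
  (forall e, polyfun (f e)) ->
  thin (fun v => exists z, forall e, f e (joint v z) = 0) \/
  thin (fun v => ~ exists z, forall e, f e (joint v z) = 0).
Proof.
move=> pf.
(* Parameters get the variables below [#|I|] and stay free; unknowns get those from [#|I|] on and
   are quantified. *)
pose idx (s : I + Z) : nat :=
  match s with inl i => enum_rank i | inr k => #|I| + enum_rank k end.
have [t Ht] := choice (fun e => polyfun_term idx (pf e)).
pose conj := foldr (fun e phi => GRing.And (GRing.Equal (t e) (GRing.Const 0)) phi)
  (GRing.Bool true).
pose vars := [seq (#|I| + k)%N | k <- iota 0 #|Z|].
pose phi := foldr GRing.Exists (conj (enum E)) vars.
have conjP e : GRing.holds e (conj (enum E)) <->
    forall x, f x (fun s => nth 0 e (idx s)) = 0.
  transitivity (forall x, x \in enum E -> f x (fun s => nth 0 e (idx s)) = 0).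
    elim: (enum E) => [|x l IH] //=; rewrite IH (proj2 (Ht x)); split.
      by move=> [Hx Hl] y; rewrite inE => /predU1P[->|/Hl].
    by move=> H; split=> [|y yl]; apply: H; rewrite inE ?eqxx ?yl ?orbT.
  by split=> H x; rewrite ?mem_enum; auto; apply: H; rewrite mem_enum.
have phiP v : GRing.holds (env v) phi <-> exists z, forall e, f e (joint v z) = 0.
  rewrite -GRing.foldExistsP; split.
    move=> [e' Hvars /conjP He]; exists (fun k => nth 0 e' (idx (inr k))) => e.
    rewrite -[RHS](He e); congr (f e _); apply: funext => -[i|k] //=.
    rewrite -Hvars; last first.
      rewrite !inE; apply/negP => /mapP[k _ ek]; have := ltn_ord (enum_rank i).
      by rewrite ek ltnNge leq_addr.
    by rewrite (nth_env _ _ i) ltn_ord nth_enum_rank.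
  move=> [z Hz]; exists (env v ++ env z).
    move=> k; rewrite !inE => kvars; rewrite nth_cat size_env.
    case: ltnP => // Ik; rewrite !nth_default ?size_env //.
    rewrite leqNgt; apply: contra kvars => kZ; apply/mapP; exists (k - #|I|)%N.
      by rewrite mem_iota.
    by rewrite subnKC.
  apply/conjP => e; rewrite -[RHS](Hz e); congr (f e _); apply: funext => -[i|k] /=.
    rewrite nth_cat size_env ltn_ord (nth_env _ _ i) ltn_ord.
    by rewrite nth_enum_rank.
  rewrite nth_cat size_env ltnNge leq_addr /= addKn (nth_env _ _ k) ltn_ord.
  by rewrite nth_enum_rank.
have rphi : GRing.rformula phi.
  rewrite /phi; elim: (vars) => //=; elim: (enum E) => //= e l ->.
  by rewrite (proj1 (Ht e)).
have ax : GRing.closed_field_axiom K := @solve_monicpoly K.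
have wf := @ClosedFieldQE.wf_ex_elim K.
have ok := ClosedFieldQE.holds_ex_elim ax.
have /andP[qq rq] := GRing.quantifier_elim_wf wf rphi.
have [b Hb] := qf_generic I qq rq.
case: b Hb => Hb; [right|left]; apply: thin_sub Hb => v.
  by move=> nX qX; apply: nX; apply/phiP/(GRing.quantifier_elim_rformP wf ok).
by move=> /phiP/(GRing.quantifier_elim_rformP wf ok _ rphi)->.
Qed.

End Dichotomy.

(** * Subrepresentations in coordinates *)

Lemma pi_choice (A : Type) (B : A -> Type) (P : forall a, B a -> Prop) :
  (forall a, exists b, P a b) -> exists f : forall a, B a, forall a, P a (f a).
Proof.
move=> H; exists (fun a => sval (cid (H a))) => a.
by case: (cid (H a)).
Qed.

Definition entries (A : finType) (r c : A -> nat) : finType :=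
  {a : A & ('I_(r a) * 'I_(c a))%type}.

Section MatrixFamilies.
Variables (K : fieldType) (A : finType) (r c : A -> nat).

Definition of_entries (x : entries r c -> K) (a : A) : 'M[K]_(r a, c a) :=
  \matrix_(i, j) x (existT _ a (i, j)).

Definition entries_of (M : forall a, 'M[K]_(r a, c a)) (e : entries r c) : K :=
  let: existT a (i, j) := e in M a i j.

Lemma entries_ofK M : of_entries (entries_of M) = M.
Proof.
by apply: functional_extensionality_dep => a; apply/matrixP => i j; rewrite mxE.
Qed.

Lemma of_entriesK x : entries_of (of_entries x) = x.
Proof. by apply: funext => -[a [i j]]; rewrite /= mxE. Qed.

Lemma card_entries : #|entries r c| = (\sum_a r a * c a)%N.
Proof.
rewrite card_tagged sumnE big_map big_enum /=.
by apply: eq_bigr => a _; rewrite card_prod !card_ord.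
Qed.

Lemma pmx_of_entries (I : Type) (s : entries r c -> I) a :
  pmx (fun x : I -> K => of_entries (fun e => x (s e)) a).
Proof.
move=> i j; apply: eq_polyfun (polyfun_coord K (s (existT _ a (i, j)))) => x.
by rewrite mxE.
Qed.

End MatrixFamilies.

Section Subreps.
Variables (K : fieldType) (Q : quiver).
Implicit Types b n : vertex Q -> nat.

Definition mrep n := forall a : arrow Q, 'M[K]_(n (src a), n (tgt a)).

Definition arrow_entries b n : finType :=
  entries (fun a : arrow Q => b (src a)) (fun a => n (tgt a)).

Definition mrep_of n (x : arrow_entries n n -> K) : mrep n := of_entries x.

(** Row vector convention: maps act on the right, and the subspace at x is the row space of [U x].
    An explicit basis keeps the condition first order over the field. *)
Definition has_subrep b n (v : mrep n) := exists U : forall x, 'M[K]_(b x, n x),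
  (forall x, row_free (U x)) /\
  forall a, (U (src a) *m v a <= U (tgt a))%MS.

(** The relation <=_Q in coordinates. *)
Definition always_subrep b n :=
  (forall x, (b x <= n x)%N) /\ forall v : mrep n, has_subrep b v.

Lemma row_free_rank (m n k : nat) (T : 'M[K]_(m, n)) : \rank T = k ->
  exists U : 'M[K]_(k, n), row_free U /\ (U :=: T)%MS.
Proof.
by move<-; exists (row_base T); split; [apply: row_base_free|apply: eq_row_base].
Qed.

Lemma has_subrep_rank b n (v : mrep n) (m : vertex Q -> nat)
    (T : forall x, 'M[K]_(m x, n x)) :
  (forall x, \rank (T x) = b x) ->
  (forall a, (T (src a) *m v a <= T (tgt a))%MS) -> has_subrep b v.
Proof.
move=> rT vT; have [U HU] := pi_choice (fun x => row_free_rank (rT x)).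
exists U; split => [x|a]; first by case: (HU x).
rewrite (HU (tgt a)).2; apply: submx_trans (vT a).
by apply: submxMr; rewrite (HU (src a)).2.
Qed.

Lemma has_subrep_leq b n (v : mrep n) : has_subrep b v -> forall x, (b x <= n x)%N.
Proof. by move=> [U [fU _]] x; rewrite -(eqP (fU x)) rank_leq_col. Qed.

Lemma always_subrep_refl n : always_subrep n n.
Proof.
split=> // v; exists (fun x => 1%:M); split=> [x|a]; last exact: submx1.
by rewrite row_free_unit unitmx1.
Qed.

Lemma has_subrep_trans b c n (v : mrep n) :
  has_subrep c v -> always_subrep b c -> has_subrep b v.
Proof.
move=> [U [fU vU]] [_ Hbc].
have [w Hw] := pi_choice (fun a => submxP (vU a)).
have [S [fS wS]] := Hbc w.
exists (fun x => S x *m U x); split=> [x|a].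
  by rewrite /row_free mxrankMfree ?fU //; apply: fS.
by rewrite -mulmxA Hw mulmxA submxMr.
Qed.

Lemma always_subrep_trans b c n :
  always_subrep b c -> always_subrep c n -> always_subrep b n.
Proof.
move=> bc cn; split=> [x|v]; last exact: has_subrep_trans (cn.2 v) bc.
exact: leq_trans (bc.1 x) (cn.1 x).
Qed.

End Subreps.

Section GenericSubreps.
Variables (K : numClosedFieldType) (Q : quiver).
Implicit Types b n : vertex Q -> nat.

(** Rank and inclusion become polynomial equations once a right inverse V of the basis U and the
    matrices W of the restricted maps are added as unknowns: U V = 1 and U v = W U. *)
Lemma has_subrep_dichotomy b n :
  thin (fun x : arrow_entries n n -> K => has_subrep b (mrep_of x)) \/
  thin (fun x : arrow_entries n n -> K => ~ has_subrep b (mrep_of x)).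
Proof.
pose I := arrow_entries n n; pose Z1 := entries b n; pose Z2 := entries n b.
pose Z3 := arrow_entries b b.
pose Z : finType := ((Z1 + Z2) + Z3)%type.
pose U (y : I + Z -> K) x := of_entries (fun e : Z1 => y (inr (inl (inl e)))) x.
pose V (y : I + Z -> K) x := of_entries (fun e : Z2 => y (inr (inl (inr e)))) x.
pose W (y : I + Z -> K) a := of_entries (fun e : Z3 => y (inr (inr e))) a.
pose v (y : I + Z -> K) a := of_entries (fun e : I => y (inl e)) a.
pose E : finType := (entries b b + arrow_entries b n)%type.
pose f (e : E) (y : I + Z -> K) : K := match e with
  | inl e => entries_of (fun x => U y x *m V y x - 1%:M) e
  | inr e => entries_of (fun a => U y (src a) *m v y a - W y a *m U y (tgt a)) e
  end.
have pf e : polyfun (f e).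
  have pU x : pmx (U^~ x) by apply: (pmx_of_entries K (fun e : Z1 => inr (inl (inl e)))).
  have pV x : pmx (V^~ x) by apply: (pmx_of_entries K (fun e : Z2 => inr (inl (inr e)))).
  have pW a : pmx (W^~ a) by apply: (pmx_of_entries K (fun e : Z3 => inr (inr e))).
  have pv a : pmx (v^~ a) by apply: (pmx_of_entries K (fun e : I => inl e)).
  case: e => -[a [i j]] /=.
    exact: (pmx_sub (pmx_mul (pU a) (pV a)) (pmx_const _ _) i j).
  exact: (pmx_sub (pmx_mul (pU _) (pv a)) (pmx_mul (pW a) (pU _)) i j).
suff H y : has_subrep b (mrep_of y) <-> exists z, forall e, f e (joint y z) = 0.
  case: (generic_dichotomy pf) => H'; [left|right];
  by apply: thin_sub H' => y; rewrite H.
split.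
  move=> [U0 [fU vU]].
  have [V0 HV] := pi_choice (fun x => row_freeP (fU x)).
  have [W0 HW] := pi_choice (fun a => submxP (vU a)).
  exists (joint (joint (entries_of U0) (entries_of V0)) (entries_of W0)).
  have EU z : U (joint y (joint (joint (entries_of U0) (entries_of V0)) z)) = U0.
    by rewrite -[RHS]entries_ofK.
  have EV z : V (joint y (joint (joint (entries_of U0) (entries_of V0)) z)) = V0.
    by rewrite -[RHS]entries_ofK.
  have EW z : W (joint y (joint z (entries_of W0))) = W0.
    by rewrite -[RHS]entries_ofK.
  case=> -[a [i j]] /=; rewrite EU ?EV ?EW.
    by rewrite HV subrr mxE.
  by rewrite -HW subrr mxE.
move=> [z Hz]; exists (U (joint y z)); split=> [x|a].
  apply/row_freeP; exists (V (joint y z) x); apply/eqP; rewrite -subr_eq0.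
  by apply/eqP/matrixP => i j; rewrite [RHS]mxE -(Hz (inl (existT _ x (i, j)))).
apply/submxP; exists (W (joint y z) a); apply/eqP; rewrite -subr_eq0.
by apply/eqP/matrixP => i j; rewrite [RHS]mxE -(Hz (inr (existT _ a (i, j)))).
Qed.

End GenericSubreps.

(** * Closedness over the complex numbers *)

Section NormalForm.
Variable K : numFieldType.

Lemma cofactor_col n (A B : 'M[K]_n) i j :
  col' j A = col' j B -> cofactor A i j = cofactor B i j.
Proof. by move=> AB; rewrite /cofactor AB. Qed.

(* Choosing a maximal minor of largest norm makes, by Cramer's rule, the other
   entries of the normalized basis at most 1 in norm. *)
Lemma bounded_row_basis b n (U : 'M[K]_(b, n)) : row_free U ->
  exists (s : {ffun 'I_b -> 'I_n}) (U' : 'M[K]_(b, n)),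
    [/\ (U' :=: U)%MS, colsub s U' = 1%:M & forall i j, `|U' i j| <= 1].
Proof.
move=> fU.
have fullU : row_full U^T by rewrite /row_full mxrank_tr; apply: fU.
have detU (s : 'I_b -> 'I_n) : \det (rowsub s U^T) = \det (colsub s U).
  by rewrite -det_tr; congr (\det _); apply/matrixP => i j; rewrite !mxE.
pose s0 : {ffun 'I_b -> 'I_n} := [ffun i => fullrankfun fullU i].
have s0U : \det (colsub s0 U) != 0.
  rewrite -detU -unitfE -unitmxE.
  have -> : rowsub s0 U^T = rowsub (fullrankfun fullU) U^T.
    by apply/matrixP => i j; rewrite !mxE ffunE.
  by rewrite -row_full_unit; apply: fullrowsub_full.
pose F (s : {ffun 'I_b -> 'I_n}) := `|\det (colsub s U)|.
have [||s _ maxs] := @comparable_arg_maxP _ _ _ s0 xpredT F.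
- by [].
- by move=> i j _ _; apply: real_comparable; apply: normr_real.
have dets : \det (colsub s U) != 0.
  by rewrite -normr_gt0 (lt_le_trans _ (maxs s0 isT)) // normr_gt0.
have unitC : colsub s U \in unitmx by rewrite unitmxE unitfE.
pose U' := invmx (colsub s U) *m U.
have sU' : colsub s U' = 1%:M.
  by rewrite /U' -mulmx_colsub mulVmx.
exists s, U'; split=> // [|i j].
  apply/eqmxP; rewrite /U' submxMl /= -[X in (X <= _)%MS](mulKVmx unitC U).
  exact: submxMl.
pose s' : {ffun 'I_b -> 'I_n} := [ffun k => if k == i then j else s k].
have eqU : colsub s' U = colsub s U *m colsub s' U'.
  by rewrite mulmx_colsub /U' mulKVmx.
(* Apart from its i-th column, [colsub s' U'] is the identity matrix, so expansion along that column
   leaves one entry. *)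
have detU' : \det (colsub s' U') = U' i j.
  rewrite (expand_det_col _ i) (bigD1 i) //= [X in _ + X]big1 ?addr0.
    rewrite !mxE ffunE eqxx (cofactor_col (B := 1%:M)).
      suff -> : cofactor 1%:M i i = 1 :> K by rewrite mulr1.
      have := mul_mx_adj (1%:M : 'M[K]_b).
      by rewrite mul1mx det1 => /matrixP/(_ i i); rewrite !mxE eqxx.
    apply/matrixP => k l; rewrite !mxE ffunE eq_sym (negPf (neq_lift _ _)).
    by move/matrixP/(_ k (lift i l)): sU'; rewrite !mxE.
  move=> k ki; rewrite (cofactor_col (B := 1%:M)).
    have := mul_mx_adj (1%:M : 'M[K]_b).
    rewrite mul1mx det1 => /matrixP/(_ i k); rewrite !mxE eq_sym (negPf ki) => ->.
    by rewrite mulr0.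
  apply/matrixP => p l; rewrite !mxE ffunE eq_sym (negPf (neq_lift _ _)).
  by move/matrixP/(_ p (lift i l)): sU'; rewrite !mxE.
have := maxs s' isT; rewrite /= /F eqU det_mulmx detU' normrM.
by rewrite ger_pMr // normr_gt0.
Qed.

End NormalForm.

Section Ultralimit.
Import numFieldNormedType.Exports.
Variable R : realType.
Local Notation C := (complex R).
Local Open Scope classical_set_scope.

(** Along such a filter every bounded sequence converges and every sequence in a finite set is
    eventually constant, so all entries and all pivot choices settle at once, without successive
    subsequences. *)
Lemma exists_ultrafilter : exists G : set_system nat, UltraFilter G /\ \oo `<=` G.
Proof. exact: ultraFilterLemma. Qed.

Variable G : set_system nat.
Hypothesis ultraG : UltraFilter G.
Hypothesis ooG : \oo `<=` G.

Let filterG : ProperFilter G := @ultra_proper _ _ ultraG.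
#[local] Existing Instance filterG.

Definition ucvg (z : nat -> C) (l : C) :=
  (fun k => complex.Re (z k)) @ G --> complex.Re l /\ (fun k => complex.Im (z k)) @ G --> complex.Im l.

Lemma ucvg_const (l : C) : ucvg (fun=> l) l.
Proof. by split; apply: cvg_cst. Qed.

Lemma ucvgD z w l m : ucvg z l -> ucvg w m -> ucvg (fun k => z k + w k) (l + m).
Proof.
move=> [zr zi] [wr wi]; split.
  rewrite (_ : (fun k => _) = (fun k => complex.Re (z k)) + (fun k => complex.Re (w k))).
    by rewrite raddfD; apply: cvgD.
  by apply: funext => k; rewrite raddfD.
rewrite (_ : (fun k => _) = (fun k => complex.Im (z k)) + (fun k => complex.Im (w k))).
  by rewrite raddfD; apply: cvgD.
by apply: funext => k; rewrite raddfD.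
Qed.

Lemma ReM (x y : C) : complex.Re (x * y) = complex.Re x * complex.Re y - complex.Im x * complex.Im y.
Proof. by case: x y => a b [c d]. Qed.

Lemma ImM (x y : C) : complex.Im (x * y) = complex.Re x * complex.Im y + complex.Im x * complex.Re y.
Proof. by case: x y => a b [c d]. Qed.

Lemma ucvgM z w l m : ucvg z l -> ucvg w m -> ucvg (fun k => z k * w k) (l * m).
Proof.
move=> [zr zi] [wr wi]; split.
  under eq_fun do rewrite ReM; rewrite ReM.
  by apply: cvgB; apply: cvgM.
under eq_fun do rewrite ImM; rewrite ImM.
by apply: cvgD; apply: cvgM.
Qed.

Lemma ucvg_unique z w l m :
  ucvg z l -> ucvg w m -> (\forall k \near G, z k = w k) -> l = m.
Proof.
move=> [zr zi] [wr wi] zw.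
have zwr : (fun k => complex.Re (z k)) @ G --> complex.Re m.
  apply: cvg_trans wr; apply: near_eq_cvg.
  by apply: filterS zw => k ->.
have zwi : (fun k => complex.Im (z k)) @ G --> complex.Im m.
  apply: cvg_trans wi; apply: near_eq_cvg.
  by apply: filterS zw => k ->.
apply/eqP; rewrite eq_complex; apply/andP; split; apply/eqP.
  exact: (@norm_cvg_unique R R _ _ _ _ zr zwr).
exact: (@norm_cvg_unique R R _ _ _ _ zi zwi).
Qed.

Lemma ultra_fmap (T : Type) (f : nat -> T) : UltraFilter (f @ G).
Proof.
apply: Build_UltraFilter => H properH fGH; apply/seteqP; split=> // A HA.
have [//|GnA] := in_ultra_setVsetC (f @^-1` A) ultraG.
have HnA : H (~` A) by apply: fGH.
by have /filter_ex[x []] : H (A `&` ~` A) by apply: filterI.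
Qed.

Lemma bounded_cvg (f : nat -> R) (M : R) :
  (forall k, `|f k| <= M) -> exists l : R, f @ G --> l.
Proof.
move=> fM; have := @segment_compact R (- M) M; rewrite compact_ultra => cM.
have [|l [_ fl]] := cM (f @ G) (ultra_fmap f); last by exists l.
by apply: (@filterE _ G) => k; rewrite /preimage /= in_itv /= -ler_norml; apply: fM.
Qed.

Lemma bounded_ucvg (z : nat -> C) : (forall k, `|z k| <= 1) -> exists l, ucvg z l.
Proof.
move=> zM.
have [|a Ha] := @bounded_cvg (fun k => complex.Re (z k)) 1.
  by move=> k; have := le_trans (normc_ge_Re (z k)) (zM k); rewrite lecR.
have [|b Hb] := @bounded_cvg (fun k => complex.Im (z k)) 1.
  move=> k; have := normc_ge_Re (z k * 'i%C).
  rewrite ReiNIm normrN normrM complexiE normCi mulr1 => /le_trans/(_ (zM k)).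
  by rewrite lecR.
by exists (Complex a b).
Qed.

Lemma ucvg_inv m : ucvg (fun k => (k + m).+1%:R^-1) 0.
Proof.
have E k : k.+1%:R^-1 = (k.+1%:R^-1)%:C%C :> C.
  by rewrite -(rmorph_nat (real_complex R)) fmorphV.
split; last first.
  by under eq_fun do rewrite E; apply: cvg_cst.
under eq_fun do rewrite E.
apply: (@cvg_trans _ ((fun k => (k + m).+1%:R^-1 : R) @ \oo)).
  by apply: cvg_app.
rewrite (cvg_shiftn m (fun k => k.+1%:R^-1 : R)).
exact: cvg_harmonic.
Qed.

Lemma ultra_pigeonhole (T : finType) (f : nat -> T) : exists t, \forall k \near G, f k = t.
Proof.
apply: contrapT => H.
have : \forall k \near G, forall t, f k <> t.
  apply: filter_forall => t.
  have [ft|//] := in_ultra_setVsetC [set k | f k = t] ultraG.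
  by case: H; exists t.
by move=> /filter_ex[k /(_ (f k))].
Qed.

End Ultralimit.

Section Closedness.
Variable R : realType.
Local Notation C := (complex R).
Local Open Scope classical_set_scope.

Lemma ucvg_polyfun (G : set_system nat) (ultraG : UltraFilter G) (I : Type)
    (f : (I -> C) -> C) (z : nat -> I -> C) (l : I -> C) :
  polyfun f -> (forall i, ucvg G (z ^~ i) (l i)) ->
  ucvg G (fun k => f (z k)) (f l).
Proof.
move=> pf zl; elim: pf => [c|i|g h _ IHg _ IHh|g h _ IHg _ IHh].
- exact: ucvg_const.
- exact: zl.
- exact: ucvgD.
- exact: ucvgM.
Qed.

(** Compactness of Grassmannians made explicit: [v] is a limit of points [X k] on a line that leave
    the thin set; their subrepresentations have bases with entries of norm at most 1, which converge
    along an ultrafilter. *)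
Lemma has_subrep_closed (Q : quiver) (b n : vertex Q -> nat) :
  thin (fun x : arrow_entries n n -> C => ~ has_subrep b (mrep_of x)) ->
  forall v : mrep C n, has_subrep b v.
Proof.
move=> [f [pf [y fy] fX]] v.
have [G [ultraG ooG]] := exists_ultrafilter.
have filterG : ProperFilter G := @ultra_proper _ _ ultraG.
pose x := entries_of v.
have [p Hp] := polyfun_line x (fun e => y e - x e) pf.
have p0 : p != 0.
  apply: contra_neq fy => p0; rewrite -[RHS](horner0 1) -p0 -Hp.
  by congr f; apply: funext => i; rewrite mul1r subrKC.
have [m Hm] := finitely_many_roots p0.
pose X k e : C := x e + (k + m).+1%:R^-1 * (y e - x e).
have X_sub k : has_subrep b (mrep_of (X k)).
  apply: contrapT => /fX; rewrite /X Hp; apply/eqP.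
  by apply: Hm; rewrite leq_addl.
have X_lim e : ucvg G (X ^~ e) (x e).
  rewrite -[x e]addr0 -[X in _ + X](mul0r (y e - x e)).
  apply: ucvgD => //; first exact: ucvg_const.
  by apply: ucvgM => //; [apply: ucvg_inv|apply: ucvg_const].
have /choice[sU HsU] : forall k, exists sU :
    forall x, {ffun 'I_(b x) -> 'I_(n x)} * 'M[C]_(b x, n x),
    [/\ forall x, colsub (sU x).1 (sU x).2 = 1%:M,
        forall x i j, `|(sU x).2 i j| <= 1 &
        forall a, ((sU (src a)).2 *m mrep_of (X k) a <= (sU (tgt a)).2)%MS].
  move=> k; have [U [fU vU]] := X_sub k.
  have := pi_choice (fun x => bounded_row_basis (fU x)) => -[s /pi_choice[U' HU']].
  exists (fun x => (s x, U' x)); split=> [z|z i j|a] /=.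
  - by case: (HU' z).
  - by case: (HU' z).
  - case: (HU' (src a)) => eU _ _; case: (HU' (tgt a)) => eU' _ _.
    by rewrite eU' (eqmxMr _ eU).
(* One choice of pivot columns serves for almost all k; the identity block there survives in the
   limit, so the rank does not drop. *)
have [s Hs] := pi_choice (fun x => ultra_pigeonhole ultraG (fun k => (sU k x).1)).
have /pi_choice[U HU] : forall z, exists U : 'M[C]_(b z, n z),
    forall i j, ucvg G (fun k => (sU k z).2 i j) (U i j).
  move=> z.
  have H ij : exists l, ucvg G (fun k => (sU k z).2 ij.1 ij.2) l.
    by apply: bounded_ucvg => // k; case: (HsU k).
  have [F HF] := choice H.
  exists (\matrix_(i, j) F (i, j)) => i j; rewrite mxE; exact: (HF (i, j)).
have mulmx_lim p' q r (A : nat -> 'M[C]_(p', q)) (B : nat -> 'M[C]_(q, r))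
      (A0 : 'M[C]_(p', q)) (B0 : 'M[C]_(q, r)) :
    (forall i j, ucvg G (fun k => A k i j) (A0 i j)) ->
    (forall i j, ucvg G (fun k => B k i j) (B0 i j)) ->
    forall i j, ucvg G (fun k => (A k *m B k) i j) ((A0 *m B0) i j).
  move=> HA HB i j.
  pose h (z : 'I_q + 'I_q -> C) := \sum_(l < q) z (inl l) * z (inr l).
  have ph : polyfun h.
    by apply: polyfun_sum => l _; apply: polyfun_mul; apply: polyfun_coord.
  have := @ucvg_polyfun G ultraG _ h (fun k => joint (A k i) (B k ^~ j))
    (joint (A0 i) (B0 ^~ j)) ph.
  rewrite /h /=.
  rewrite (_ : (fun k : nat => (A k *m B k) i j) = (fun k : nat => \sum_l A k i l * B k l j)).
    rewrite (_ : (A0 *m B0) i j = \sum_l A0 i l * B0 l j); last by rewrite mxE.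
    by apply=> -[l|l] /=; [apply: HA|apply: HB].
  by apply: funext => k; rewrite mxE.
have cs1 z : colsub (s z) (U z) = 1%:M.
  apply/matrixP => i j; rewrite mxE.
  apply: (@ucvg_unique _ _ ultraG (fun k => (sU k z).2 i (s z j)) (fun=> (1%:M : 'M_(b z)) i j)).
  - exact: HU.
  - exact: ucvg_const.
  - apply: filterS (Hs z) => k <-; case: (HsU k) => /(_ z)/matrixP/(_ i j) + _ _.
    by rewrite mxE.
exists U; split=> [z|a].
  by apply/row_freeP; exists (colsub (s z) 1%:M); rewrite mulmx_colsub mulmx1 cs1.
(* As the basis is the identity on the pivot columns, the coefficients of a vector in its row space
   are the entries in these columns. Inclusion is thus a matrix identity, which passes to the
   limit. *)
apply/submxP; exists (colsub (s (tgt a)) (U (src a) *m v a)).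
have Xv i j : ucvg G (fun k => mrep_of (X k) a i j) (v a i j).
  rewrite (_ : (fun k => _) = X ^~ (existT _ a (i, j))); first exact: X_lim.
  by apply: funext => k; rewrite mxE.
have UX := mulmx_lim _ _ _ _ _ _ _ (HU (src a)) Xv.
have UXs i j : ucvg G (fun k => colsub (s (tgt a)) ((sU k (src a)).2 *m mrep_of (X k) a) i j)
    (colsub (s (tgt a)) (U (src a) *m v a) i j).
  by rewrite mxE; under eq_fun do rewrite mxE; apply: UX.
have UXU := mulmx_lim _ _ _ _ _ _ _ UXs (HU (tgt a)).
apply/matrixP => i j; apply: (ucvg_unique _ (UX i j) (UXU i j)) => //.
apply: filterS (Hs (tgt a)) => k <-; case: (HsU k) => /(_ (tgt a)) cs _ /(_ a)/submxP[T ->].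
by rewrite -mulmx_colsub cs mulmx1.
Qed.

End Closedness.

(** * Charts *)

(** The upper b rows, [1 | k] with permuted columns, form an affine chart of Gr(b, b + d). The lower
    rows complete them to a basis whose inverse, [coframe], is again polynomial in k. *)
HB.lock Definition frame (K : fieldType) b d (k : 'M[K]_(b, d)) (s : 'S_(b + d)) :
  'M[K]_(b + d) := block_mx 1%:M k 0 1%:M *m perm_mx s.

HB.lock Definition coframe (K : fieldType) b d (k : 'M[K]_(b, d)) (s : 'S_(b + d)) :
  'M[K]_(b + d) := perm_mx s^-1 *m block_mx 1%:M (- k) 0 1%:M.

Section Frames.
Variable K : fieldType.

Lemma perm_extend m k (f : 'I_m -> 'I_(m + k)) : injective f ->
  exists s : 'S_(m + k), forall i, s (lshift k i) = f i.
Proof.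
move=> injf; pose s := codom f ++ [seq j <- enum 'I_(m + k) | j \notin codom f].
have us : uniq s.
  rewrite cat_uniq (map_inj_uniq injf) enum_uniq filter_uniq ?enum_uniq // andbT /=.
  by apply/hasPn => j; rewrite mem_filter => /andP[].
have ps : perm_eq s (enum 'I_(m + k)).
  apply: uniq_perm => //; first exact: enum_uniq.
  by move=> j; rewrite mem_cat mem_filter mem_enum andbT orbN.
have ss : size s == (m + k)%N by rewrite (perm_size ps) size_enum_ord.
have [p Hp] := tuple_permP (t := ord_tuple (m + k)) (s := Tuple ss) ps.
exists p => i.
have Hn j : tnth (Tuple ss) j = p j.
  by rewrite (tnth_nth j) /= [s]Hp -(tnth_nth j [tuple _ | _ < _]) tnth_mktuple tnth_ord_tuple.
rewrite -Hn (tnth_nth (f i)) /= nth_cat size_codom card_ord ltn_ord.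
by rewrite (nth_map i) ?size_enum_ord // nth_ord_enum.
Qed.

Lemma pivot_perm m k (M : 'M[K]_(m, m + k)) : row_free M ->
  exists s : 'S_(m + k), lsubmx (M *m perm_mx s^-1) \in unitmx.
Proof.
move=> fM.
have fullM : row_full M^T by rewrite /row_full mxrank_tr; apply: fM.
have [s Hs] := perm_extend (@fullrankfun_inj _ _ _ _ fullM).
exists s; rewrite -unitmx_tr.
rewrite (_ : _^T = rowsub (fullrankfun fullM) M^T).
  by rewrite -row_full_unit fullrowsub_full.
apply/matrixP => i j; rewrite -col_permE !mxE; congr (M _ _).
by rewrite Hs.
Qed.

Lemma frameK b d (k : 'M[K]_(b, d)) s : frame k s *m coframe k s = 1%:M.
Proof.
rewrite frame.unlock coframe.unlock mulmxA -(mulmxA _ (perm_mx s)) -perm_mxM mulgV perm_mx1.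
by rewrite mulmx1 mulmx_block !mul1mx !mulmx1 !mul0mx !mulmx0 !addr0 !add0r addNr -scalar_mx_block.
Qed.

Lemma coframeK b d (k : 'M[K]_(b, d)) s : coframe k s *m frame k s = 1%:M.
Proof. exact: (mulmx1C (frameK k s)). Qed.

Lemma frameP b d (U : 'M[K]_(b, b + d)) : row_free U ->
  exists s k, (U :=: usubmx (frame k s))%MS.
Proof.
move=> fU; have [s us] := pivot_perm fU.
set V := U *m perm_mx s^-1 in us.
exists s, (invmx (lsubmx V) *m rsubmx V).
rewrite frame.unlock -mul_usub_mx block_mxEv col_mxKu.
have -> : row_mx 1%:M (invmx (lsubmx V) *m rsubmx V) = invmx (lsubmx V) *m V.
  by rewrite -[X in _ = _ *m X](hsubmxK V) mul_mx_row mulVmx.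
rewrite -mulmxA /V -(mulmxA U) -perm_mxM mulVg perm_mx1 mulmx1.
by apply/eqmxP; rewrite submxMl andbT -{1}(mulKVmx us U) submxMl.
Qed.

End Frames.

Section PolynomialFrames.
Variables (K : fieldType) (I : Type).

Lemma pmx_block m1 m2 n1 n2 (F1 : (I -> K) -> 'M[K]_(m1, n1)) (F2 : (I -> K) -> 'M[K]_(m1, n2))
    (F3 : (I -> K) -> 'M[K]_(m2, n1)) (F4 : (I -> K) -> 'M[K]_(m2, n2)) :
  pmx F1 -> pmx F2 -> pmx F3 -> pmx F4 ->
  pmx (fun x => block_mx (F1 x) (F2 x) (F3 x) (F4 x)).
Proof.
move=> p1 p2 p3 p4; have := pmx_col (pmx_row p1 p2) (pmx_row p3 p4).
by move=> + i j => /(_ i j); apply: eq_polyfun => x; rewrite block_mxEv.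
Qed.

Lemma pmx_frame b d (F : (I -> K) -> 'M[K]_(b, d)) s :
  pmx F -> pmx (fun x => frame (F x) s).
Proof.
move=> pF; rewrite frame.unlock; apply: pmx_mul (pmx_const _ _).
by apply: pmx_block => //; apply: pmx_const.
Qed.

Lemma pmx_coframe b d (F : (I -> K) -> 'M[K]_(b, d)) s :
  pmx F -> pmx (fun x => coframe (F x) s).
Proof.
move=> pF; rewrite coframe.unlock; apply: pmx_mul; first exact: pmx_const.
by apply: pmx_block => //; [apply: pmx_const|apply: pmx_opp|apply: pmx_const|apply: pmx_const].
Qed.

End PolynomialFrames.

Section Charts.
Variable Q : quiver.
Implicit Types b c d n : vertex Q -> nat.

(** The two halves of the Euler form, kept apart as natural numbers because each is also a number of
    coordinates: of the families phi, and of the families of matrices along arrows. *)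
Definition vertex_form b c : nat := (\sum_x b x * c x)%N.
Definition arrow_form b c : nat := (\sum_(a : arrow Q) b (src a) * c (tgt a))%N.

Lemma card_vertex_entries b c : #|entries b c| = vertex_form b c.
Proof. exact: card_entries. Qed.

Lemma card_arrow_entries b c : #|arrow_entries b c| = arrow_form b c.
Proof. exact: card_entries. Qed.

Lemma vertex_formDl b c d :
  vertex_form (fun x => b x + c x)%N d = (vertex_form b d + vertex_form c d)%N.
Proof. by rewrite -big_split; apply: eq_bigr => x _; rewrite mulnDl. Qed.

Lemma vertex_formDr b c d :
  vertex_form b (fun x => c x + d x)%N = (vertex_form b c + vertex_form b d)%N.
Proof. by rewrite -big_split; apply: eq_bigr => x _; rewrite mulnDr. Qed.

Lemma arrow_formDl b c d :
  arrow_form (fun x => b x + c x)%N d = (arrow_form b d + arrow_form c d)%N.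
Proof. by rewrite -big_split; apply: eq_bigr => x _; rewrite mulnDl. Qed.

Lemma arrow_formDr b c d :
  arrow_form b (fun x => c x + d x)%N = (arrow_form b c + arrow_form b d)%N.
Proof. by rewrite -big_split; apply: eq_bigr => x _; rewrite mulnDr. Qed.

Variable K : numFieldType.

Lemma not_thin_setT (I : Type) (X : (I -> K) -> Prop) : thin X -> exists x, ~ X x.
Proof.
move=> [f [_ [x fx] fX]]; exists x => /fX fx0.
by rewrite fx0 eqxx in fx.
Qed.

Section Conjugates.
Variables b d : vertex Q -> nat.
Local Notation n := (fun x => b x + d x)%N.
Variables (s : forall x, 'S_(b x + d x)) (k : forall x, 'M[K]_(b x, d x)).

(** Blocks are taken in the frame bases, so the chart point [k] is a subrepresentation precisely
    when [v2] vanishes; then [v1] is the subrepresentation and [v4] the quotient. *)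
Definition block_rep (v1 : mrep K b) (v2 : forall a : arrow Q, 'M[K]_(b (src a), d (tgt a)))
    (v3 : forall a : arrow Q, 'M[K]_(d (src a), b (tgt a))) (v4 : mrep K d) : mrep K n :=
  fun a => coframe (k (src a)) (s (src a)) *m block_mx (v1 a) (v2 a) (v3 a) (v4 a)
    *m frame (k (tgt a)) (s (tgt a)).

Lemma block_rep_exists (v : mrep K n) :
  exists v1 v2 v3 v4, v = block_rep v1 v2 v3 v4.
Proof.
pose w a : 'M_(b (src a) + d (src a), b (tgt a) + d (tgt a)) :=
  frame (k (src a)) (s (src a)) *m v a *m coframe (k (tgt a)) (s (tgt a)).
exists (fun a => ulsubmx (w a)), (fun a => ursubmx (w a)),
  (fun a => dlsubmx (w a)), (fun a => drsubmx (w a)).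
apply: functional_extensionality_dep => a.

by rewrite /block_rep submxK /w !mulmxA coframeK mul1mx -mulmxA coframeK mulmx1.
Qed.

Lemma frame_stable v1 v2 v3 v4 a :
  (usubmx (frame (k (src a)) (s (src a))) *m block_rep v1 v2 v3 v4 a <=
    usubmx (frame (k (tgt a)) (s (tgt a))))%MS -> v2 a = 0.
Proof.
rewrite mul_usub_mx /block_rep !mulmxA frameK mul1mx => /submxP[T].
rewrite -mul_usub_mx block_mxEv col_mxKu => HT.
have : row_mx (v1 a) (v2 a) = row_mx T 0.
  rewrite -[LHS]mulmx1 -(frameK (k (tgt a)) (s (tgt a))) mulmxA HT -mulmxA.
  rewrite mul_usub_mx frameK scalar_mx_block block_mxEv col_mxKu mul_mx_row.
  by rewrite mulmx1 mulmx0.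
by case/eq_row_mx.
Qed.

End Conjugates.

(** A representation with a subrepresentation of dimension b is given by a chart point, costing
    [vertex_form b d] parameters, and by its blocks without [v2], saving [arrow_form b d]. The
    contrapositive gives the necessity of (A). *)
Lemma has_subrep_thin b d : (vertex_form b d < arrow_form b d)%N ->
  let n x := (b x + d x)%N in
  thin (fun x : arrow_entries n n -> K => has_subrep b (mrep_of x)).
Proof.
move=> lt_bd n.
pose I : finType := (entries b d + (arrow_entries b b + (arrow_entries d b + arrow_entries d d)))%type.
pose k (y : I -> K) x := of_entries (fun e : entries b d => y (inl e)) x.
pose v1 (y : I -> K) a := of_entries (fun e : arrow_entries b b => y (inr (inl e))) a.
pose v3 (y : I -> K) a := of_entries (fun e : arrow_entries d b => y (inr (inr (inl e)))) a.
pose v4 (y : I -> K) a := of_entries (fun e : arrow_entries d d => y (inr (inr (inr e)))) a.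
have pk x : pmx (k^~ x) by apply: (pmx_of_entries K (fun e : entries b d => inl e)).
have p1 a : pmx (v1^~ a) by apply: (pmx_of_entries K (fun e : arrow_entries b b => inr (inl e))).
have p3 a : pmx (v3^~ a) by apply: (pmx_of_entries K (fun e : arrow_entries d b => inr (inr (inl e)))).
have p4 a : pmx (v4^~ a) by apply: (pmx_of_entries K (fun e : arrow_entries d d => inr (inr (inr e)))).
pose S : finType := {dffun forall x : vertex Q, 'S_(b x + d x)}.
pose rho (s : S) (y : I -> K) := block_rep s (k y) (v1 y) (fun=> 0) (v3 y) (v4 y).
have prho s a : pmx (fun y => rho s y a).
  apply: pmx_mul (pmx_frame _ (pk _)); apply: pmx_mul; first exact: (pmx_coframe _ (pk _)).
  by apply: pmx_block => //; apply: pmx_const.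
pose q (_ : I -> K) : K := 1.
pose Y (y : arrow_entries n n -> K) := exists s : S, exists2 x, q x != 0 &
  forall e, y e * q x = entries_of (rho s x) e.
suff XY y : has_subrep b (mrep_of y) -> Y y.
  apply: thin_sub XY _.
  apply: thin_exists => s; apply: (image_thin (p := fun e x => entries_of (rho s x) e)).
  - rewrite !card_sum (card_arrow_entries n n) !card_arrow_entries card_vertex_entries.
    by rewrite /n !arrow_formDl !arrow_formDr; lia.
  - by move=> [a [i j]]; apply: prho.
  - exact: polyfun_const.
move=> [U [fU vU]].
have [s0 /pi_choice[k0 Hk]] := pi_choice (fun x => frameP (fU x)).
have [w1 [w2 [w3 [w4 Hw]]]] := block_rep_exists s0 k0 (mrep_of y).
have w20 : w2 = fun=> 0.
  apply: functional_extensionality_dep => a.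
  apply: (@frame_stable _ _ s0 k0 w1 w2 w3 w4 a).
  by rewrite -Hw -(Hk (tgt a)) -(eqmxMr _ (Hk (src a))).
rewrite w20 in Hw.
exists [ffun x => s0 x].
exists (joint (entries_of k0) (joint (entries_of w1) (joint (entries_of w3) (entries_of w4)))).
  exact: oner_neq0.
move=> e; rewrite mulr1 /rho.
have -> : k (joint (entries_of k0) (joint (entries_of w1) (joint (entries_of w3) (entries_of w4)))) = k0.
  by rewrite -[RHS]entries_ofK.
have -> : v1 (joint (entries_of k0) (joint (entries_of w1) (joint (entries_of w3) (entries_of w4)))) = w1.
  by rewrite -[RHS]entries_ofK.
have -> : v3 (joint (entries_of k0) (joint (entries_of w1) (joint (entries_of w3) (entries_of w4)))) = w3.
  by rewrite -[RHS]entries_ofK.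
have -> : v4 (joint (entries_of k0) (joint (entries_of w1) (joint (entries_of w3) (entries_of w4)))) = w4.
  by rewrite -[RHS]entries_ofK.
rewrite (_ : fun_of_fin _ = s0); last first.
  by apply: functional_extensionality_dep => x; rewrite ffunE.
by rewrite -Hw /mrep_of of_entriesK.
Qed.

Lemma always_subrep_forms b d : always_subrep K b (fun x => b x + d x)%N ->
  (arrow_form b d <= vertex_form b d)%N.
Proof.
move=> [_ H]; rewrite leqNgt; apply/negP => /has_subrep_thin/not_thin_setT[x].
by apply; apply: H.
Qed.

End Charts.

(** * Homomorphisms of prescribed rank *)

Section Homs.
Variables (K : fieldType) (Q : quiver).
Implicit Types b c d n : vertex Q -> nat.

Definition hom_diff b c (u : mrep K b) (w : mrep K c)
    (phi : forall x, 'M[K]_(b x, c x)) (a : arrow Q) : 'M[K]_(b (src a), c (tgt a)) :=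
  u a *m phi (tgt a) - phi (src a) *m w a.

Lemma hom_diff_eq b c (u : mrep K b) (w : mrep K c) phi :
  (forall a, hom_diff u w phi a = 0) ->
  forall a, u a *m phi (tgt a) = phi (src a) *m w a.
Proof. by move=> H a; apply/eqP; rewrite -subr_eq0; apply/eqP; apply: H. Qed.

Lemma hom_has_subreps b d c (u : mrep K b) (w : mrep K c) phi :
  (forall a, hom_diff u w phi a = 0) -> (forall x, \rank (phi x) = d x) ->
  has_subrep (fun x => b x - d x)%N u /\ has_subrep d w.
Proof.
move=> /hom_diff_eq Hphi rphi; split.
  apply: (has_subrep_rank (T := fun x => kermx (phi x))) => [x|a].
    by rewrite mxrank_ker rphi.
  by apply/sub_kermxP; rewrite -mulmxA Hphi mulmxA mulmx_ker mul0mx.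
apply: (has_subrep_rank (T := phi)) => // a.
by rewrite -Hphi submxMl.
Qed.

Lemma row_free_complement m k (psi : 'M[K]_(m, m + k)) : row_free psi ->
  exists t : 'S_(m + k), col_mx psi (row_mx 0 1%:M *m perm_mx t) \in unitmx.
Proof.
move=> /pivot_perm[t ut]; exists t.
have E : col_mx psi (row_mx 0 1%:M *m perm_mx t) *m perm_mx t^-1 =
    block_mx (lsubmx (psi *m perm_mx t^-1)) (rsubmx (psi *m perm_mx t^-1)) 0 1%:M.
  rewrite mul_col_mx -mulmxA -perm_mxM mulgV perm_mx1 mulmx1.
  by rewrite block_mxEv hsubmxK.
have : col_mx psi (row_mx 0 1%:M *m perm_mx t) *m perm_mx t^-1 \in unitmx.
  by rewrite E unitmxE det_ublock det1 mulr1 -unitmxE.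
by rewrite unitmx_mul => /andP[].
Qed.

End Homs.

Section HomCharts.
Variables (K : numFieldType) (Q : quiver) (b d c : vertex Q -> nat).
Local Notation m := (fun x => b x + d x)%N.
Local Notation n := (fun x => d x + c x)%N.

Definition completion (psi : forall x, 'M[K]_(d x, d x + c x))
    (t : forall x, 'S_(d x + c x)) x : 'M[K]_(d x + c x) :=
  col_mx (psi x) (row_mx 0 1%:M *m perm_mx (t x)).

(** The chart point [k] is the kernel of phi and the rows of [psi] are a basis of its image. On the
    image [w] is forced by the quotient block [v4] of [u]; only its values [z] on the completing
    rows are free. *)
Lemma hom_normal_form (u : mrep K m) (w : mrep K n) phi :
  (forall a, hom_diff u w phi a = 0) -> (forall x, \rank (phi x) = d x) ->
  exists s k v1 v3 v4 t psi z,
  [/\ u = block_rep s k v1 (fun=> 0) v3 v4,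
      forall x, phi x = coframe (k x) (s x) *m col_mx 0 (psi x),
      forall x, completion psi t x \in unitmx &
      forall a, w a = invmx (completion psi t (src a)) *m
        col_mx (v4 a *m psi (tgt a)) (z a)].
Proof.
move=> /hom_diff_eq Hphi rphi.
have rker x : \rank (kermx (phi x)) = b x.
  by rewrite mxrank_ker rphi addnK.
have [U HU] := pi_choice (fun x => row_free_rank (rker x)).
have [s /pi_choice[k Hk]] := pi_choice (fun x => frameP (HU x).1).
pose F x := frame (k x) (s x); pose psi x := dsubmx (F x *m phi x).
have unitF x : F x \in unitmx.
  by case: (mulmx1_unit (frameK (k x) (s x))).
have Fphi x : F x *m phi x = col_mx 0 (psi x).
  rewrite -[LHS]vsubmxK -mul_usub_mx; congr (col_mx _ _).
  by apply/sub_kermxP; rewrite -(Hk x) (HU x).2.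
have fpsi x : row_free (psi x).
  have : \rank (F x *m phi x) = d x.
    by rewrite (eqmxMfull (phi x)) ?row_full_unit.
  by rewrite Fphi rank_col_0mx => /eqP.
have [t Ht] := pi_choice (fun x => row_free_complement (fpsi x)).
have [v1 [v2 [v3 [v4 Hu]]]] := block_rep_exists s k u.
have phiE x : phi x = coframe (k x) (s x) *m col_mx 0 (psi x).
  by rewrite -Fphi mulmxA coframeK mul1mx.
have HN a : block_mx (v1 a) (v2 a) (v3 a) (v4 a) *m col_mx 0 (psi (tgt a)) =
    col_mx 0 (psi (src a) *m w a).
  have := Hphi a; rewrite Hu /block_rep => /(congr1 (mulmx (F (src a)))).
  rewrite !mulmxA frameK mul1mx -mulmxA !Fphi => ->.
  by rewrite mul_col_mx mul0mx.
have v20 : v2 = fun=> 0.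
  apply: functional_extensionality_dep => a.
  have := HN a; rewrite mul_block_col !mulmx0 !add0r => /eq_col_mx[E _].
  by apply: (row_free_inj (fpsi (tgt a))); rewrite E mul0mx.
have wpsi a : v4 a *m psi (tgt a) = psi (src a) *m w a.
  by have := HN a; rewrite mul_block_col !mulmx0 !add0r => /eq_col_mx[_ E].
exists s, k, v1, v3, v4, t, psi,
  (fun a => row_mx 0 1%:M *m perm_mx (t (src a)) *m w a); split=> //.
- by rewrite Hu v20.
- by move=> a; rewrite wpsi -mul_col_mx mulKmx //; apply: Ht.
Qed.

(** In the normal form, kernel and image basis cost [vertex_form b d + vertex_form d n] parameters,
    while the zero block of [u] and the forced rows of [w] save [arrow_form b d + arrow_form d n].
    The h further target coordinates are functions of phi and cost nothing. *)
Lemma hom_rank_thin (h : nat) (l : 'I_h -> (entries m n -> K) -> K) :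
  (forall j, polyfun (l j)) ->
  (vertex_form b d + vertex_form d n < arrow_form b d + arrow_form d n + h)%N ->
  thin (fun y : (arrow_entries m m + arrow_entries n n) + 'I_h -> K =>
    exists phi,
    [/\ forall a, hom_diff (mrep_of (fun e => y (inl (inl e))))
          (mrep_of (fun e => y (inl (inr e)))) phi a = 0,
        forall x, \rank (phi x) = d x &
        forall j, y (inr j) = l j (entries_of phi)]).
Proof.
move=> pl lt_forms.
pose I1 := entries b d; pose I2 := entries d n; pose I3 := arrow_entries b b.
pose I4 := arrow_entries d b; pose I5 := arrow_entries d d; pose I6 := arrow_entries c n.
pose I : finType := (I1 + (I2 + (I3 + (I4 + (I5 + I6)))))%type.
pose k (y : I -> K) x := of_entries (fun e : I1 => y (inl e)) x.
pose psi (y : I -> K) x := of_entries (fun e : I2 => y (inr (inl e))) x.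
pose v1 (y : I -> K) a := of_entries (fun e : I3 => y (inr (inr (inl e)))) a.
pose v3 (y : I -> K) a := of_entries (fun e : I4 => y (inr (inr (inr (inl e))))) a.
pose v4 (y : I -> K) a := of_entries (fun e : I5 => y (inr (inr (inr (inr (inl e)))))) a.
pose z (y : I -> K) a := of_entries (fun e : I6 => y (inr (inr (inr (inr (inr e)))))) a.
have pk x : pmx (k^~ x) by apply: (pmx_of_entries K (fun e : I1 => inl e)).
have ppsi x : pmx (psi^~ x) by apply: (pmx_of_entries K (fun e : I2 => inr (inl e))).
have p1 a : pmx (v1^~ a) by apply: (pmx_of_entries K (fun e : I3 => inr (inr (inl e)))).
have p3 a : pmx (v3^~ a) by apply: (pmx_of_entries K (fun e : I4 => inr (inr (inr (inl e))))).
have p4 a : pmx (v4^~ a) by apply: (pmx_of_entries K (fun e : I5 => inr (inr (inr (inr (inl e)))))).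
have pz a : pmx (z^~ a) by apply: (pmx_of_entries K (fun e : I6 => inr (inr (inr (inr (inr e)))))).
pose S : finType := ({dffun forall x : vertex Q, 'S_(b x + d x)} *
                     {dffun forall x : vertex Q, 'S_(d x + c x)})%type.
pose u (s : S) (y : I -> K) := block_rep s.1 (k y) (v1 y) (fun=> 0) (v3 y) (v4 y).
pose G (s : S) (y : I -> K) x := completion (psi y) s.2 x.
pose phi (s : S) (y : I -> K) x := coframe (k y x) (s.1 x) *m col_mx 0 (psi y x).
(* w is recovered from psi by Cramer's rule; q clears the denominators. *)
pose q (s : S) (y : I -> K) := \prod_x \det (G s y x).
pose qw (s : S) (y : I -> K) a := (\prod_(x | x != src a) \det (G s y x)) *:
   (\adj (G s y (src a)) *m col_mx (v4 y a *m psi y (tgt a)) (z y a)).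
have pu s a : pmx (fun y => u s y a).
  apply: pmx_mul (pmx_frame _ (pk _)); apply: pmx_mul; first exact: (pmx_coframe _ (pk _)).
  by apply: pmx_block => //; apply: pmx_const.
have pG s x : pmx (fun y => G s y x) by apply: pmx_col => //; apply: pmx_const.
have pphi s x : pmx (fun y => phi s y x).
  by apply: pmx_mul; [apply: pmx_coframe|apply: pmx_col => //; apply: pmx_const].
have pq s : polyfun (q s) by apply: polyfun_prod => x _; apply: polyfun_det.
have pqw s a : pmx (fun y => qw s y a).
  apply: pmx_scale; first by apply: polyfun_prod => x _; apply: polyfun_det.
  apply: pmx_mul; first exact: pmx_adj.
  by apply: pmx_col => //; apply: pmx_mul.
pose J : finType := ((arrow_entries m m + arrow_entries n n) + 'I_h)%type.
pose p (s : S) (j : J) (y : I -> K) : K := match j with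
  | inl (inl e) => q s y * entries_of (u s y) e
  | inl (inr e) => entries_of (qw s y) e
  | inr j => q s y * l j (entries_of (phi s y)) end.
pose Y (y : J -> K) := exists s : S, exists2 x, q s x != 0 &
  forall e, y e * q s x = p s e x.
match goal with |- thin ?X => suff XY y : X y -> Y y end.
  apply: thin_sub XY _.
  apply: thin_exists => s; apply: image_thin => //.
  - rewrite !card_sum (card_arrow_entries m m) (card_arrow_entries n n).
    rewrite (card_arrow_entries c n) (card_vertex_entries d n) !card_arrow_entries.
    rewrite card_vertex_entries card_ord.
    rewrite (arrow_formDl b d) (arrow_formDl d c) !(arrow_formDr _ b d).
    lia.
  - case=> [[[a [i j]]|[a [i j]]]|j] /=.
    + by apply: polyfun_mul => //; apply: pu.
    + exact: pqw.
    + apply: polyfun_mul => //.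
      apply: (polyfun_comp (h := fun e y => entries_of (phi s y) e)) => // -[x [i' j']].
      exact: pphi.
move=> [f [Hf rf lf]].
have [s [k0 [w1 [w3 [w4 [t [psi0 [z0 [Hu Hphi Hunit Hw]]]]]]]]] := hom_normal_form Hf rf.
exists ([ffun x => s x], [ffun x => t x]).
pose pt : I -> K := joint (entries_of k0) (joint (entries_of psi0) (joint (entries_of w1)
  (joint (entries_of w3) (joint (entries_of w4) (entries_of z0))))).
have sE : fun_of_fin ([ffun x => s x] : {dffun forall x : vertex Q, 'S_(b x + d x)}) = s.
  by apply: functional_extensionality_dep => x; rewrite ffunE.
have tE : fun_of_fin ([ffun x => t x] : {dffun forall x : vertex Q, 'S_(d x + c x)}) = t.
  by apply: functional_extensionality_dep => x; rewrite ffunE.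
have kE : k pt = k0 by rewrite -[RHS]entries_ofK.
have psiE : psi pt = psi0 by rewrite -[RHS]entries_ofK.
have v1E : v1 pt = w1 by rewrite -[RHS]entries_ofK.
have v3E : v3 pt = w3 by rewrite -[RHS]entries_ofK.
have v4E : v4 pt = w4 by rewrite -[RHS]entries_ofK.
have zE : z pt = z0 by rewrite -[RHS]entries_ofK.
have GE : G ([ffun x => s x], [ffun x => t x]) pt = completion psi0 t.
  by rewrite /G psiE /= tE.
have detG x : \det (completion psi0 t x) != 0.
  by rewrite -unitfE -unitmxE.
exists pt.
  by rewrite /q GE; apply/prodf_neq0 => x _.
have uE : mrep_of (fun e => y (inl (inl e))) = u ([ffun x => s x], [ffun x => t x]) pt.
  by rewrite Hu /u kE v1E v3E v4E /= sE.
have phiE : f = phi ([ffun x => s x], [ffun x => t x]) pt.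
  by apply: functional_extensionality_dep => x; rewrite Hphi /phi kE psiE /= sE.
case=> [[e|e]|j].
- by rewrite /p -uE of_entriesK mulrC.
- rewrite /p; transitivity (entries_of (mrep_of (fun e => y (inl (inr e)))) e *
    q ([ffun x => s x], [ffun x => t x]) pt).
    by rewrite of_entriesK.
  case: e => a [i j]; rewrite /entries_of Hw /qw GE v4E psiE zE /q GE.
  have -> : invmx (completion psi0 t (src a)) =
      (\det (completion psi0 t (src a)))^-1 *: \adj (completion psi0 t (src a)).
    by rewrite /invmx Hunit.
  rewrite (bigD1 (src a)) //= -scalemxAl; move: (\adj _ *m _) => M.
  by rewrite !mxE mulrAC -!mulrA mulKf // mulrC.
- by rewrite /p lf phiE mulrC.
Qed.

End HomCharts.

(** * Homomorphisms and extensions *)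

Section HomMatrix.
Variable K : fieldType.

Definition flat (T : finType) (f : T -> K) : 'rV[K]_#|T| := \row_p f (enum_val p).
Definition unflat (T : finType) (r : 'rV[K]_#|T|) (e : T) : K := r 0 (enum_rank e).

Lemma flatK (T : finType) (f : T -> K) : unflat (flat f) = f.
Proof. by apply: funext => e; rewrite /unflat mxE enum_rankK. Qed.

Lemma unflatK (T : finType) (r : 'rV[K]_#|T|) : flat (unflat r) = r.
Proof. by apply/rowP => p; rewrite mxE /unflat enum_valK. Qed.

Lemma flat_eq0 (A : finType) (r c : A -> nat) (M : forall a, 'M[K]_(r a, c a)) :
  flat (entries_of M) = 0 <-> forall a, M a = 0.
Proof.
split=> [M0 a|M0].
  apply/matrixP => i j; have /(congr1 (@unflat _)) := M0.
  by rewrite flatK => /(congr1 (fun f => f (existT _ a (i, j)))) /= ->; rewrite /unflat !mxE.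
by apply/rowP => p; rewrite mxE; case: (enum_val p) => a [i j] /=; rewrite M0 !mxE.
Qed.

Variable Q : quiver.
Implicit Types b c d n : vertex Q -> nat.

Section HomMx.
Variables (b c : vertex Q -> nat) (u : mrep K b) (w : mrep K c).

Definition hom_row (r : 'rV[K]_#|entries b c|) : 'rV[K]_#|arrow_entries b c| :=
  flat (entries_of (hom_diff u w (of_entries (unflat r)))).

Lemma hom_row_linear : linear hom_row.
Proof.
move=> k r r'; apply/rowP => p; rewrite !mxE.
case: (enum_val p) => a [i j]; rewrite /entries_of /hom_diff.
have E x : of_entries (unflat (k *: r + r')) x =
    k *: of_entries (unflat r) x + of_entries (unflat r') x :> 'M_(b x, c x).
  by apply/matrixP => i' j'; rewrite !mxE /unflat !mxE.
rewrite !E mulmxDr mulmxDl -scalemxAl -scalemxAr opprD addrACA -scalerBr.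
by rewrite [in LHS]mxE [in X in X + _]mxE.
Qed.
HB.instance Definition _ := GRing.isSemilinear.Build K _ _ _ hom_row
  (GRing.semilinear_linear hom_row_linear).

(** In row convention the left kernel is Hom(u, w), and [row_full] expresses Ext(u, w) = 0. *)
Definition hom_mx := lin1_mx hom_row.

Lemma mul_hom_mx phi : flat (entries_of phi) *m hom_mx =
  flat (entries_of (hom_diff u w phi)).
Proof. by rewrite mul_rV_lin1 /= /hom_row flatK entries_ofK. Qed.

Lemma hom_mxP phi : flat (entries_of phi) *m hom_mx = 0 <->
  forall a, hom_diff u w phi a = 0.
Proof. by rewrite mul_hom_mx flat_eq0. Qed.

End HomMx.

Lemma pmx_hom_mx I b c (u : (I -> K) -> mrep K b) (w : (I -> K) -> mrep K c) :
  (forall a, pmx (fun y => u y a)) -> (forall a, pmx (fun y => w y a)) ->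
  pmx (fun y => hom_mx (u y) (w y)).
Proof.
move=> pu pw i j.
pose phi := of_entries (unflat (delta_mx 0 i)) : forall x, 'M[K]_(b x, c x).
apply: (eq_polyfun (f := fun y => entries_of (hom_diff (u y) (w y) phi) (enum_val j))).
  by move=> y; rewrite !mxE.
case: (enum_val j) => a [i' j'] /=.
by apply: (pmx_sub (pmx_mul (pu a) (pmx_const _ _)) (pmx_mul (pmx_const _ _) (pw a))).
Qed.

(** Composition with the inclusion embeds Hom(u, w') into Hom(u, w) for the subrepresentation w' of
    dimension d, and dim Hom(u, w') is at least [vertex_form b d - arrow_form b d]. *)
Lemma hom_mx_rank_sub b c d (u : mrep K b) (w : mrep K c) : has_subrep d w ->
  (\rank (hom_mx u w) + vertex_form b d <= vertex_form b c + arrow_form b d)%N.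
Proof.
move=> [V [fV wV]]; have [T HT] := pi_choice (fun a => submxP (wV a)).
pose f (r : 'rV[K]_#|entries b d|) : 'rV[K]_#|entries b c| :=
  flat (entries_of (fun x => of_entries (unflat r) x *m V x)).
have lf : linear f.
  move=> k r r'; apply/rowP => p; rewrite !mxE.
  case: (enum_val p) => x [i j]; rewrite /entries_of.
  have -> : of_entries (unflat (k *: r + r')) x =
      k *: of_entries (unflat r) x + of_entries (unflat r') x :> 'M_(b x, d x).
    by apply/matrixP => i' j'; rewrite !mxE /unflat !mxE.
  by rewrite mulmxDl -scalemxAl [in LHS]mxE [in X in X + _]mxE.
pose fM := GRing.isSemilinear.Build K _ _ _ f (GRing.semilinear_linear lf).
pose F : {linear _ -> _} := HB.pack f fM.
pose J := lin1_mx F.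
have JE r : r *m J = f r by rewrite mul_rV_lin1.
have fJ : row_free J.
  apply: inj_row_free => r; rewrite JE => /flat_eq0 H.
  rewrite -[r]unflatK -(of_entriesK (unflat r)); apply/flat_eq0 => x.
  by apply: (row_free_inj (fV x)); rewrite H mul0mx.
have sub : (kermx (hom_mx u T) *m J <= kermx (hom_mx u w))%MS.
  apply/rV_subP => r /submxP[s ->]; apply/sub_kermxP.
  set r' := s *m kermx (hom_mx u T).
  have : r' *m hom_mx u T = 0 by rewrite -mulmxA mulmx_ker mulmx0.
  rewrite -[r']unflatK -(of_entriesK (unflat r')) hom_mxP => /hom_diff_eq H.
  rewrite mulmxA -/r' JE; apply/hom_mxP => a; apply/eqP; rewrite subr_eq0.
  by rewrite mulmxA H -!mulmxA HT.
have := mxrankS sub; rewrite mxrankMfree // !mxrank_ker.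
have := rank_leq_col (hom_mx u T); have := rank_leq_row (hom_mx u w).
have := card_vertex_entries b d; have := card_vertex_entries b c.
have := card_arrow_entries b d; lia.
Qed.

End HomMatrix.

Section Valuation.
Variables (K : numFieldType) (I : Type).
Let at_ (y : I -> K) (t : K) : I + unit -> K := joint y (fun=> t).

Lemma polyfun_poly (f : (I + unit -> K) -> K) : polyfun f ->
  exists (p : (I -> K) -> {poly K}) d, [/\ forall k, polyfun (fun y => (p y)`_k),
    forall y, (size (p y) <= d)%N & forall y t, f (at_ y t) = (p y).[t]].
Proof.
elim=> [c|[i|[]]|g h _ [p [d [pp sp Hp]]] _ [q [e [pq sq Hq]]]
       |g h _ [p [d [pp sp Hp]]] _ [q [e [pq sq Hq]]]].
- exists (fun=> c%:P), 1%N; split=> [k|y|y t]; first exact: polyfun_const.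
    exact: size_polyC_leq1.
  by rewrite hornerC.
- exists (fun y => (y i)%:P), 1%N; split=> [k|y|y t]; last by rewrite hornerC.
    case: k => [|k].
      by apply: eq_polyfun (polyfun_coord K i) => y; rewrite coefC.
    by apply: eq_polyfun (polyfun_const I 0) => y; rewrite coefC.
  exact: size_polyC_leq1.
- exists (fun=> 'X), 2%N; split=> [k|y|y t]; first exact: polyfun_const.
    by rewrite size_polyX.
  by rewrite hornerX.
- exists (fun y => p y + q y), (maxn d e); split=> [k|y|y t].
  + by apply: eq_polyfun (polyfun_add (pp k) (pq k)) => y; rewrite coefD.
  + by apply: leq_trans (size_polyD _ _) _; have := sp y; have := sq y; lia.
  + by rewrite hornerD Hp Hq.
- exists (fun y => p y * q y), (d + e)%N; split=> [k|y|y t].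
  + apply: (eq_polyfun (f := fun y => \sum_(j < k.+1) (p y)`_j * (q y)`_(k - j))).
      by move=> y; rewrite coefM.
    by apply: polyfun_sum => j _; apply: polyfun_mul.
  + by apply: leq_trans (size_polyMleq _ _) _; have := sp y; have := sq y; lia.
  + by rewrite hornerM Hp Hq.
Qed.

(** [t ^+ k] is the lowest power of t whose coefficient is not identically zero in y, and [g] at t =
    0 is that coefficient. *)
Lemma polyfun_valuation (f : (I + unit -> K) -> K) : polyfun f ->
  (exists x, f x != 0) -> exists k g, [/\ polyfun g,
    forall y t, f (at_ y t) = t ^+ k * g (at_ y t) & exists y, g (at_ y 0) != 0].
Proof.
move=> /polyfun_poly[p [d [pp sp Hp]]] [x fx].
have [k0 Hk0] : exists k, `[< exists y, (p y)`_k != 0 >].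
  apply: contrapT => H; move/eqP: fx; apply.
  have -> : x = at_ (fun i => x (inl i)) (x (inr tt)) by apply: funext => -[i|[]].
  rewrite Hp; suff -> : p (fun i => x (inl i)) = 0 by rewrite horner0.
  apply/polyP => k; rewrite coef0; apply/eqP; apply: contrapT => /negP nz.
  by apply: H; exists k; apply/asboolP; exists (fun i => x (inl i)).
have [k /asboolP[y ky] mink] := ex_minnP (ex_intro _ k0 Hk0 : exists k, `[< exists y, (p y)`_k != 0 >]).
pose g (x : I + unit -> K) :=
  \sum_(j < d) (p (fun i => x (inl i)))`_(k + j) * x (inr tt) ^+ j.
have gE y' t : g (at_ y' t) = (drop_poly k (p y')).[t].
  rewrite (horner_coef_wide (n := d)); last first.
    by rewrite size_drop_poly; have := sp y'; lia.
  by apply: eq_bigr => j _; rewrite coef_drop_poly addnC.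
exists k, g; split.
- apply: polyfun_sum => j _; apply: polyfun_mul.
    by apply: (polyfun_comp (pp _)) => i; apply: polyfun_coord.
  elim: (val j) => [|m IH]; first exact: polyfun_const.
  apply: eq_polyfun (polyfun_mul (polyfun_coord K (inr tt)) IH) => z.
  by rewrite exprS.
- move=> y' t; rewrite Hp gE -[p y' in LHS](poly_take_drop k).
  rewrite hornerD hornerM hornerXn mulrC.
  suff -> : take_poly k (p y') = 0 by rewrite horner0 add0r.
  apply/polyP => j; rewrite coef_take_poly coef0; case: ltnP => // jk.
  apply/eqP; apply: contrapT => /negP nz.
  by have := mink j; rewrite leqNgt jk => H; apply/notF/H/asboolP; exists y'.
- by exists y; rewrite gE horner_coef0 coef_drop_poly.
Qed.

End Valuation.

(** Closedness in the form in which it is used: what holds off a thin set holds everywhere. As a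
    hypothesis on K it separates the algebra from the limit argument. *)
Definition subreps_specialize (K : fieldType) := forall (Q : quiver) (b n : vertex Q -> nat),
  thin (fun x : arrow_entries n n -> K => ~ has_subrep b (mrep_of x)) ->
  forall v : mrep K n, has_subrep b v.

(** * Generic representations and vanishing Ext *)

Section Generic.
Variables (K : numClosedFieldType) (Q : quiver).
Hypothesis closedK : subreps_specialize K.
Implicit Types b c d n : vertex Q -> nat.

Lemma always_subrep_or_thin b n : always_subrep K b n \/
  thin (fun x : arrow_entries n n -> K => has_subrep b (mrep_of x)).
Proof.
case: (has_subrep_dichotomy K b n) => [|H]; [by right|left].
have always v := closedK H v; split=> // x.
exact: (has_subrep_leq (always (fun a => 0))).
Qed.

(** Only the finitely many b bounded by n can occur, and each of them is either always realised or
    realised on a thin set. *)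
Lemma generic_subreps n : thin (fun x : arrow_entries n n -> K =>
  exists b, has_subrep b (mrep_of x) /\ ~ always_subrep K b n).
Proof.
pose T : finType := {dffun forall x : vertex Q, 'I_(n x).+1}.
pose X (b : T) (y : arrow_entries n n -> K) :=
  has_subrep (fun x => b x : nat) (mrep_of y) /\ ~ always_subrep K (fun x => b x : nat) n.
apply: (thin_sub (Y := fun y => exists b : T, X b y)).
  move=> y [b [Hb nb]]; exists [ffun x => inord (b x)].
  suff E : (fun x => ([ffun x => inord (b x)] : T) x : nat) = b by rewrite /X E.
  by apply: funext => x; rewrite ffunE inordK // ltnS (has_subrep_leq Hb).
apply: thin_exists => b; have [ab|tb] := always_subrep_or_thin (fun x => b x : nat) n.
  exists (fun=> 1); split; first exact: polyfun_const.
    by exists (fun=> 0); rewrite oner_neq0.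
  by move=> y [_ /(_ ab)].
by apply: thin_sub tb => y [].
Qed.

Lemma row_full_open I (m n : nat) (F : (I -> K) -> 'M[K]_(m, n)) y0 : pmx F ->
  row_full (F y0) -> exists g, [/\ polyfun g, g y0 != 0 & forall y, g y != 0 -> row_full (F y)].
Proof.
move=> pF /row_fullP[Z HZ]; exists (fun y => \det (Z *m F y)); split.
- by apply: polyfun_det; apply: pmx_mul => //; apply: pmx_const.
- by rewrite HZ det1 oner_neq0.
move=> y; rewrite -unitfE -unitmxE => uy.
by apply/row_fullP; exists (invmx (Z *m F y) *m Z); rewrite -mulmxA mulVmx.
Qed.

Lemma row_free_open I (m n : nat) (F : (I -> K) -> 'M[K]_(m, n)) y0 : pmx F ->
  row_free (F y0) -> exists g, [/\ polyfun g, g y0 != 0 & forall y, g y != 0 -> row_free (F y)].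
Proof.
move=> pF /row_freeP[Z HZ]; exists (fun y => \det (F y *m Z)); split.
- by apply: polyfun_det; apply: pmx_mul => //; apply: pmx_const.
- by rewrite HZ det1 oner_neq0.
move=> y; rewrite -unitfE -unitmxE => uy.
by apply/row_freeP; exists (Z *m invmx (F y *m Z)); rewrite mulmxA mulmxV.
Qed.

(* A graph [1 | phi] is a subrepresentation of [[p, q], [r, s]] iff
   p phi - phi s + phi r phi = q; scaling r by t and keeping the lowest order
   in t reduces this Riccati equation to the linear equation. *)
Lemma hom_mx_full_always b c (u0 : mrep K b) (w0 : mrep K c) :
  row_full (hom_mx u0 w0) -> always_subrep K b (fun x => b x + c x)%N.
Proof.
move=> full0; set n := fun x => _.
have [//|[f [pf [y1 fy1] fX]]] := always_subrep_or_thin b n.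
pose I1 := arrow_entries b b; pose I2 := arrow_entries b c.
pose I3 := arrow_entries c b; pose I4 := arrow_entries c c.
pose I : finType := (I1 + (I2 + (I3 + I4)))%type.
pose p (y : I -> K) : mrep K b := mrep_of (fun e => y (inl e)).
pose q (y : I -> K) a := of_entries (fun e : I2 => y (inr (inl e))) a.
pose r (y : I -> K) a := of_entries (fun e : I3 => y (inr (inr (inl e)))) a.
pose s (y : I -> K) : mrep K c := mrep_of (fun e => y (inr (inr (inr e)))).
have pp a : pmx (fun y => p y a) by apply: (pmx_of_entries K (fun e : I1 => inl e)).
have ps a : pmx (fun y => s y a) by apply: (pmx_of_entries K (fun e : I4 => inr (inr (inr e)))).
pose V (x : I + unit -> K) : mrep K n := fun a =>
  let y i := x (inl i) in block_mx (p y a) (q y a) (x (inr tt) *: r y a) (s y a).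
pose F (x : I + unit -> K) := f (entries_of (V x)).
have pF : polyfun F.
  apply: (polyfun_comp (h := fun e x => entries_of (V x) e)) => // -[a [i j]].
  apply: (@pmx_block _ _ _ _ _ _ (fun x => p (fun i => x (inl i)) a)
    (fun x => q (fun i => x (inl i)) a) (fun x => x (inr tt) *: r (fun i => x (inl i)) a)
    (fun x => s (fun i => x (inl i)) a)).
  - by apply: (pmx_of_entries K (fun e : I1 => inl (inl e))).
  - by apply: (pmx_of_entries K (fun e : I2 => inl (inr (inl e)))).
  - apply: pmx_scale; first exact: polyfun_coord.
    by apply: (pmx_of_entries K (fun e : I3 => inl (inr (inr (inl e))))).
  - by apply: (pmx_of_entries K (fun e : I4 => inl (inr (inr (inr e))))).
pose pt (p1 : mrep K b) (q1 : forall a, 'M[K]_(b (src a), c (tgt a)))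
  (r1 : forall a, 'M[K]_(c (src a), b (tgt a))) (s1 : mrep K c) : I -> K :=
  joint (entries_of p1) (joint (entries_of q1) (joint (entries_of r1) (entries_of s1))).
have ptp p1 q1 r1 s1 : p (pt p1 q1 r1 s1) = p1 by rewrite -[RHS]entries_ofK.
have ptq p1 q1 r1 s1 : q (pt p1 q1 r1 s1) = q1 by rewrite -[RHS]entries_ofK.
have ptr p1 q1 r1 s1 : r (pt p1 q1 r1 s1) = r1 by rewrite -[RHS]entries_ofK.
have pts p1 q1 r1 s1 : s (pt p1 q1 r1 s1) = s1 by rewrite -[RHS]entries_ofK.
have nF : exists x, F x != 0.
  pose v : mrep K n := mrep_of y1.
  pose v' a : 'M_(b (src a) + c (src a), b (tgt a) + c (tgt a)) := v a.
  pose y := pt (fun a => ulsubmx (v' a)) (fun a => ursubmx (v' a))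
    (fun a => dlsubmx (v' a)) (fun a => drsubmx (v' a)).
  exists (joint y (fun=> 1)); rewrite /F.
  suff -> : V (joint y (fun=> 1)) = v by rewrite /v /mrep_of of_entriesK.
  apply: functional_extensionality_dep => a.
  by rewrite /V /= ptp ptq ptr pts scale1r submxK.
have [k [g [pg Fg [y2 gy2]]]] := polyfun_valuation pF nF.
pose D (y : I -> K) := hom_mx (p y) (s y).
have pD : pmx D by apply: pmx_hom_mx.
have [g' [pg' g'0 Hg']] : exists g', [/\ polyfun g', g' (pt u0 (fun=> 0) (fun=> 0) w0) != 0 &
    forall y, g' y != 0 -> row_full (D y)].
  by apply: row_full_open pD _; rewrite /D ptp pts.
have pg0 : polyfun (fun y => g (joint y (fun=> 0))).
  by apply: polyfun_comp pg _ => -[i|[]]; [apply: polyfun_coord|apply: polyfun_const].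
have [||y] := polyfun_mul_neq0 pg0 pg'; first by exists y2.
  by exists (pt u0 (fun=> 0) (fun=> 0) w0).
rewrite mulf_eq0 negb_or => /andP[gy /Hg' /row_fullP[Z HZ]].
pose phi := of_entries (unflat (flat (entries_of (q y)) *m Z)) : forall x, 'M[K]_(b x, c x).
have Hphi a : p y a *m phi (tgt a) - phi (src a) *m s y a = q y a.
  have : flat (entries_of phi) *m D y = flat (entries_of (q y)).
    by rewrite /phi of_entriesK unflatK -mulmxA HZ mulmx1.
  rewrite mul_hom_mx => /(congr1 (@unflat _ _)); rewrite !flatK.
  by move=> /(congr1 (@of_entries _ _ _ _)); rewrite !entries_ofK => <-.
(* The linear equation is solved exactly, and the quadratic error is moved into q: with q + t phi r
   phi in place of q, the graph of phi is stable for every t. This curve passes through [y] at t =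
   0, where [g] is nonzero, so [F] is nonzero at some nonzero t, against the vanishing of [f] on
   representations with such a subrepresentation. *)
pose z := entries_of (fun a => phi (src a) *m r y a *m phi (tgt a)).
pose c1 (i : I) : {poly K} := (y i)%:P + (match i with inr (inl e) => z e | _ => 0 end) *: 'X.
pose c2 (i : I + unit) : {poly K} := match i with inl i => c1 i | inr _ => 'X end.
have [h Hh] := polyfun_curve c2 pg.
have [t t0 ht] : exists2 t, t != 0 & h.[t] != 0.
  apply: poly_nonroot; apply: contra_neq gy => h0; rewrite -[RHS](horner0 0) -h0 -Hh.
  by congr g; apply: funext => -[i|[]]; rewrite /= /c1 !hornerE ?mulr0 ?addr0.
pose yt i := (c1 i).[t].
have ytE : (fun i => (c2 i).[t]) = joint yt (fun=> t).
  by apply: funext => -[i|[]]; rewrite //= hornerX.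
rewrite -Hh ytE in ht.
have : F (joint yt (fun=> t)) != 0 by rewrite Fg mulf_neq0 // expf_neq0.
rewrite /F fX ?eqxx // /mrep_of entries_ofK.
have pE : p yt = p y.
  congr mrep_of; apply: funext => e.
  by rewrite /yt /c1 scale0r addr0 hornerC.
have sE : s yt = s y.
  congr mrep_of; apply: funext => e.
  by rewrite /yt /c1 scale0r addr0 hornerC.
have rE : r yt = r y.
  congr of_entries; apply: funext => e.
  by rewrite /yt /c1 scale0r addr0 hornerC.
have qE a : q yt a = q y a + t *: (phi (src a) *m r y a *m phi (tgt a)).
  apply/matrixP => i j; rewrite !mxE /yt /c1 !hornerE.
  by rewrite /z /entries_of [in LHS]mxE mulrC.
apply: (has_subrep_rank (T := fun x => row_mx 1%:M (phi x))) => [x|a].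
  apply/eqP; change (row_free (row_mx 1%:M (phi x))).
  by apply/row_freeP; exists (col_mx 1%:M 0); rewrite mul_row_col mulmx1 mulmx0 addr0.
apply/submxP; exists (p y a + t *: (phi (src a) *m r y a)).
rewrite /V /= pE sE rE qE mul_row_block mul_mx_row !mul1mx mulmx1 -scalemxAr.
congr row_mx; rewrite -Hphi mulmxDl -scalemxAl.
by rewrite addrAC subrK.
Qed.

End Generic.

(** * The kernel of a generic homomorphism *)

Section GenericRank.
Variables (K : numClosedFieldType) (Q : quiver).
Hypothesis closedK : subreps_specialize K.
Implicit Types b c d n : vertex Q -> nat.

Lemma hom_rank_thin_sub m n d (h : nat) (l : 'I_h -> (entries m n -> K) -> K) :
  (forall x, d x <= m x)%N -> (forall x, d x <= n x)%N ->
  (forall j, polyfun (l j)) ->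
  let b x := (m x - d x)%N in
  (vertex_form b d + vertex_form d n < arrow_form b d + arrow_form d n + h)%N ->
  thin (fun y : (arrow_entries m m + arrow_entries n n) + 'I_h -> K =>
    exists phi,
    [/\ forall a, hom_diff (mrep_of (fun e => y (inl (inl e))))
          (mrep_of (fun e => y (inl (inr e)))) phi a = 0,
        forall x, \rank (phi x) = d x &
        forall j, y (inr j) = l j (entries_of phi)]).
Proof.
move=> dm dn pl b.
have mE : m = fun x => (b x + d x)%N by apply: funext => x; rewrite subnK.
have [c nE] : exists c, n = fun x => (d x + c x)%N.
  by exists (fun x => n x - d x)%N; apply: funext => x; rewrite subnKC.
move: b mE => b mE; subst m n; exact: hom_rank_thin.
Qed.

Lemma row_free_extension (p q r : nat) (D : 'M[K]_(p, q)) : (\rank D + r)%N = p ->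
  exists L : 'M[K]_(p, r), row_free (row_mx D L).
Proof.
move=> rp.
have rC : \rank (D^T)^C%MS = r by rewrite mxrank_compl mxrank_tr; lia.
have [U [fU eU]] := row_free_rank rC.
exists U^T; rewrite /row_free -mxrank_tr tr_row_mx trmxK.
rewrite -addsmxE (adds_eqmx (eqmx_refl _) eU).
by apply: (addsmx_compl_full D^T).
Qed.

(** [L] is injective on the kernel of [D], whose dimension is at least r; hence it maps that kernel
    onto all row vectors of length r. *)
Lemma kernel_section (p q r : nat) (D : 'M[K]_(p, q)) (L : 'M[K]_(p, r)) (t : 'rV_r) :
  row_free (row_mx D L) -> (\rank D + r <= p)%N ->
  exists v : 'rV_p, v *m D = 0 /\ v *m L = t.
Proof.
move=> fDL rp.
have inj : \rank (kermx D *m L) = \rank (kermx D).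
  rewrite -(mxrankMfree (kermx D) fDL) mul_mx_row mulmx_ker.
  by rewrite rank_row_0mx.
have full : row_full (kermx D *m L).
  by rewrite -col_leq_rank inj mxrank_ker; lia.
have /submxP[s ts] := submx_full t full.
exists (s *m kermx D); rewrite -mulmxA mulmx_ker mulmx0; split=> //.
by rewrite -mulmxA.
Qed.

(** Here r is the largest rank of [hom_mx] and h = N0 - r the generic dimension of Hom. Since r <
    N1, h exceeds <b, c>, whence the strict inequality; in terms of the Euler form it reads <b - d,
    c - d> < 0. *)
Lemma generic_hom_rank b c : (forall (u : mrep K b) (w : mrep K c), ~~ row_full (hom_mx u w)) ->
  (arrow_form b c <= vertex_form b c)%N ->
  exists d, [/\ forall x, (d x <= b x)%N, always_subrep K (fun x => b x - d x)%N b, always_subrep K d c,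
    exists x, (0 < d x)%N &
    (vertex_form b c + arrow_form (fun x => b x - d x)%N d + arrow_form d c <
     vertex_form (fun x => b x - d x)%N d + vertex_form d c + arrow_form b c)%N].
Proof.
move=> notfull le_forms; pose N0 := #|entries b c|; pose N1 := #|arrow_entries b c|.
have N0E : N0 = vertex_form b c := card_vertex_entries b c.
have N1E : N1 = arrow_form b c := card_arrow_entries b c.
pose P r := `[< exists (u : mrep K b) (w : mrep K c), \rank (hom_mx u w) = r >].
have exP : exists r, P r.
  by exists (\rank (hom_mx (fun=> 0) (fun=> 0) : 'M[K]_(N0, N1))); apply/asboolP; exists (fun=> 0), (fun=> 0).
have ubP r : P r -> (r <= N0)%N.
  by move=> /asboolP[u [w <-]]; apply: rank_leq_row.
have [r /asboolP[u0 [w0 r0]] maxr] := ex_maxnP exP ubP.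
have rN1 : (r < N1)%N.
  by rewrite -r0 ltn_neqAle rank_leq_col andbT; apply: notfull.
have rN0 : (r <= N0)%N by rewrite -r0 rank_leq_row.
pose h := (N0 - r)%N.
have h0 : (0 < h)%N by rewrite /h; lia.
have [L fL] : exists L : 'M[K]_(N0, h), row_free (row_mx (hom_mx u0 w0) L).
  by apply: row_free_extension; rewrite r0 subnKC.
pose I : finType := ((arrow_entries b b + arrow_entries c c) + 'I_h)%type.
pose u (y : I -> K) : mrep K b := mrep_of (fun e => y (inl (inl e))).
pose w (y : I -> K) : mrep K c := mrep_of (fun e => y (inl (inr e))).
have pu a : pmx (fun y => u y a) by apply: (pmx_of_entries K (fun e => inl (inl e))).
have pw a : pmx (fun y => w y a) by apply: (pmx_of_entries K (fun e => inl (inr e))).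
pose F (y : I -> K) := row_mx (hom_mx (u y) (w y)) L.
have pF : pmx F by apply: pmx_row; [apply: pmx_hom_mx|apply: pmx_const].
pose y0 : I -> K := joint (joint (entries_of u0) (entries_of w0)) (fun=> 0).
have [g [pg gy0 Hg]] : exists g, [/\ polyfun g, g y0 != 0 & forall y, g y != 0 -> row_free (F y)].
  apply: row_free_open pF _.
  have -> : F y0 = row_mx (hom_mx u0 w0) L; last by [].
  have -> : u0 = u y0 by rewrite -[LHS]entries_ofK.
  by have -> : w0 = w y0 by rewrite -[LHS]entries_ofK.
pose l (j : 'I_h) (x : entries b c -> K) := (flat x *m L) 0 j.
have pl j : polyfun (l j).
  apply: (eq_polyfun (f := fun x => \sum_k x (enum_val k) * L k j)).
    by move=> x; rewrite /l mxE; apply: eq_bigr => k _; rewrite mxE.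
  by apply: polyfun_sum => k _; apply: polyfun_mul; [apply: polyfun_coord|apply: polyfun_const].
apply: contrapT => noD.
have T1 : thin (fun y : I -> K => exists d, has_subrep d (u y) /\ ~ always_subrep K d b).
  by apply: (thin_reindex (s := fun e => inl (inl e)) (s' := fun i : I =>
    if i is inl (inl e) then Some e else None) _ (generic_subreps closedK b)).
have T2 : thin (fun y : I -> K => exists d, has_subrep d (w y) /\ ~ always_subrep K d c).
  by apply: (thin_reindex (s := fun e => inl (inr e)) (s' := fun i : I =>
    if i is inl (inr e) then Some e else None) _ (generic_subreps closedK c)).
pose T : finType := {dffun forall x : vertex Q, 'I_(b x).+1}.
pose X (d : T) (y : I -> K) := [/\ always_subrep K (fun x => b x - d x)%N b,
  always_subrep K (fun x => d x : nat) c, exists x, (0 < d x)%N &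
  exists phi, [/\ forall a, hom_diff (u y) (w y) phi a = 0,
    forall x, \rank (phi x) = d x & forall j, y (inr j) = l j (entries_of phi)]].
have T3 : thin (fun y : I -> K => exists d : T, X d y).
  apply: thin_exists => d.
  have [[ab ac nz]|nA] := EM [/\ always_subrep K (fun x => b x - d x)%N b,
    always_subrep K (fun x => d x : nat) c & exists x, (0 < d x)%N]; last first.
    exists (fun=> 1); split; first exact: polyfun_const.
      by exists (fun=> 0); rewrite oner_neq0.
    by move=> y [*]; case: nA.
  apply: (thin_sub (Y := fun y => exists phi, [/\ forall a, hom_diff (u y) (w y) phi a = 0,
    forall x, \rank (phi x) = d x & forall j, y (inr j) = l j (entries_of phi)])).
    by move=> y [].
  apply: (hom_rank_thin_sub (d := fun x => d x : nat)) => //.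
  - by move=> x; rewrite -ltnS.
  - by move=> x; apply: ac.1.
  (* If the parameter count fails to make this rank vector thin, then h > N0 - N1 turns the failure
     into the inequality claimed for d. *)
  rewrite ltnNge; apply/negP => le; apply: noD; exists (fun x => d x : nat); split=> //.
    by move=> x; rewrite -ltnS.
  by move: le => /=; rewrite /h; lia.
(* The second factor keeps the prescribed value of the first linear form nonzero, which forces phi
   to be nonzero. *)
have [|||y] := @polyfun_mul_neq0 _ _ g (fun y => y (inr (Ordinal h0))) pg.
- exact: polyfun_coord.
- by exists y0.
- by exists (fun=> 1); rewrite oner_neq0.
move=> gy'; have pgy : polyfun (fun y => g y * y (inr (Ordinal h0))).
  by apply: polyfun_mul => //; apply: polyfun_coord.
have [z] := thin_avoid (thin_or T1 (thin_or T2 T3)) pgy (ex_intro _ y gy').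
rewrite mulf_eq0 negb_or => /andP[/Hg fz z0] nX.
have nT1 : ~ exists d, has_subrep d (u z) /\ ~ always_subrep K d b by move=> H; apply: nX; left.
have nT2 : ~ exists d, has_subrep d (w z) /\ ~ always_subrep K d c.
  by move=> H; apply: nX; right; left.
have rz : (\rank (hom_mx (u z) (w z)) <= r)%N.
  by apply: maxr; apply/asboolP; exists (u z), (w z).
have [|v [vD vL]] := kernel_section (\row_j z (inr j)) fz; first by rewrite /h; lia.
pose phi := of_entries (unflat v) : forall x, 'M[K]_(b x, c x).
have vE : flat (entries_of phi) = v by rewrite /phi of_entriesK unflatK.
have Hphi : forall a, hom_diff (u z) (w z) phi a = 0 by apply/hom_mxP; rewrite vE.
pose d x := \rank (phi x).
have [sb sc] := hom_has_subreps Hphi (fun x => erefl (d x)).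
pose d' : T := [ffun x => inord (d x)].
have dE : (fun x => d' x : nat) = d.
  by apply: funext => x; rewrite ffunE inordK // ltnS rank_leq_row.
have bE : (fun x => b x - d' x)%N = (fun x => b x - d x)%N.
  by apply: funext => x; rewrite -dE.
apply: nX; right; right; exists d'; split.
- by rewrite bE; apply: contrapT => nb; apply: nT1; exists (fun x => b x - d x)%N.
- by rewrite dE; apply: contrapT => nc; apply: nT2; exists d.
- apply: contrapT => d0; move: z0; apply/negP; rewrite negbK.
  suff v0 : v = 0.
    by move: vL; rewrite v0 mul0mx => /rowP/(_ (Ordinal h0)); rewrite !mxE => <-.
  rewrite -vE; apply/flat_eq0 => x; apply/eqP; rewrite -mxrank_eq0 -leqn0 leqNgt.
  by apply/negP => dx; apply: d0; exists x; rewrite (congr1 (@^~ x) dE).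
- exists phi; split=> // [x|j]; first by rewrite (congr1 (@^~ x) dE).
  by rewrite /l vE vL mxE.
Qed.

Lemma subrep_of_nonfull b c :
  (forall (u : mrep K b) (w : mrep K c), ~~ row_full (hom_mx u w)) ->
  exists b', always_subrep K b' b /\ (vertex_form b' c < arrow_form b' c)%N.
Proof.
have [k] := ubnP (\sum_x b x)%N; elim: k => // k IH in b *; rewrite ltnS => bk notfull.
have [lt_forms|le_forms] := ltnP (vertex_form b c) (arrow_form b c).
  by exists b; split=> //; apply: always_subrep_refl.
have [d [db ab ac [x0 dx0] forms]] := generic_hom_rank notfull le_forms.
pose b1 x := (b x - d x)%N.
have bE : b = fun x => (b1 x + d x)%N by apply: funext => x; rewrite subnK.
have [||b' [ab' lt_b']] := IH b1; last first.
- by exists b'; split=> //; apply: always_subrep_trans ab' ab.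
(* [w] has a subrepresentation of dimension d, and <b1, c - d> < 0 makes the resulting bound on the
   rank of [hom_mx u w] smaller than its number of columns. *)
- move=> u w; apply/negP => full.
  have [_ /(_ w) dw] := ac.
  have := hom_mx_rank_sub u dw; rewrite (eqP full) card_arrow_entries.
  move: forms; rewrite -/b1 bE vertex_formDl arrow_formDl; lia.
- apply: leq_trans bk; rewrite (bigD1 x0) //= [X in (_ < X)%N](bigD1 x0) //=.
  rewrite -addSn leq_add //; first by rewrite /b1; have := db x0; lia.
  by apply: leq_sum => x _; apply: leq_subr.
Qed.

End GenericRank.

(** * Vector spaces and matrices *)

Section Coordinates.
Variable K : fieldType.

Section Subspaces.
Import passmx.
Variable (V : vectType K).
Let e := vbasis {:V}.
Let be : basis_of {:V} e := vbasisP {:V}.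

Let dim_vsof_leq (M : 'M[K]_(\dim {:V})) : (\dim (passmx.vsof e M) <= \rank M)%N.
Proof.
pose s := [seq passmx.vecof e (row i (row_base M)) | i <- enum 'I_(\rank M)].
apply: (@leq_trans (\dim <<s>>%VS)); last first.
  by apply: leq_trans (dim_span _) _; rewrite size_map size_enum_ord.
apply/dimvS/subvP => v; rewrite -passmx.rVof_sub // -(eq_row_base M).
move=> /submxP[c Hc]; rewrite -(passmx.rVofK be v) Hc mulmx_sum_row linear_sum.
apply: memv_suml => i _; rewrite linearZ memvZ // memv_span //.
by apply/mapP; exists i; rewrite ?mem_enum.
Qed.

(** The upper bound is applied to [M] and to [kermx M]; by rank-nullity both sides have the same
    sum, so both bounds are equalities. *)
Lemma dim_vsof (M : 'M[K]_(\dim {:V})) : \dim (passmx.vsof e M) = \rank M.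
Proof.
have := limg_ker_dim (passmx.hommx e e M) fullv.
rewrite capfv (passmx.lker_ker be) passmx.hommxK ?(basis_free be) //.
have := dim_vsof_leq M; have := dim_vsof_leq (kermx M).
rewrite mxrank_ker; have := rank_leq_row M; rewrite /passmx.vsof; lia.
Qed.

Lemma rank_msof (S : {vspace V}) : \rank (passmx.msof e S) = \dim S.
Proof. by rewrite -dim_vsof passmx.msofK. Qed.

End Subspaces.

Lemma msof_stable (V W : vectType K) (f : 'Hom(V, W)) (S : {vspace V}) (T : {vspace W}) :
  (f @: S <= T)%VS = (passmx.msof (vbasis {:V}) S *m passmx.mxof (vbasis {:V}) (vbasis {:W}) f
    <= passmx.msof (vbasis {:W}) T)%MS.
Proof.
have bV := vbasisP {:V}; have bW := vbasisP {:W}.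
apply/idP/idP => [/subvP fST|fST].
  apply/rV_subP => _ /submxP[r ->]; rewrite mulmxA.
  rewrite -passmx.mem_vecof // -passmx.hom_vecof // fST // memv_img //.
  by rewrite passmx.mem_vecof // submxMl.
apply/subvP => _ /memv_imgP[v vS ->].
rewrite -(passmx.rVofK bV v) (passmx.hom_vecof _ bW) passmx.mem_vecof //.
apply: submx_trans fST; apply: submxMr.
by rewrite -passmx.mem_vecof // passmx.rVofK.
Qed.

Variables (Q : quiver) (V : vertex Q -> vectType K).
Let dimV x := \dim {: V x}.
Let e x := vbasis {: V x}.

Definition mrep_of_rep (v : rep V) : mrep K dimV := mrep_of (rep_entry v).

Lemma mrep_of_repE v a : mrep_of_rep v a = passmx.mxof (e (src a)) (e (tgt a)) (v a).
Proof.
by apply/matrixP => i j; rewrite !mxE /= passmx.vecof_delta.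
Qed.

Lemma quiver_Gr_msof b (v : rep V) S : quiver_Gr b v S <->
  (forall x, \rank (passmx.msof (e x) (S x)) = b x) /\
  forall a, (passmx.msof (e (src a)) (S (src a)) *m mrep_of_rep v a <=
    passmx.msof (e (tgt a)) (S (tgt a)))%MS.
Proof.
split=> -[dS vS]; split=> [x|a].
- by rewrite rank_msof.
- by rewrite mrep_of_repE -msof_stable.
- by rewrite -rank_msof.
- by rewrite msof_stable -mrep_of_repE.
Qed.

Lemma quiver_Gr_subrep b (v : rep V) :
  (exists S, quiver_Gr b v S) <-> has_subrep b (mrep_of_rep v).
Proof.
split=> [[S /quiver_Gr_msof[dS vS]]|[U [fU vU]]]; first exact: (has_subrep_rank dS vS).
have eU x : (passmx.msof (e x) (passmx.vsof (e x) <<U x>>%MS) :=: U x)%MS.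
  by apply: eqmx_trans (genmxE _); apply/eqmxP/passmx.vsofK/vbasisP.
exists (fun x => passmx.vsof (e x) <<U x>>%MS); apply/quiver_Gr_msof; split=> [x|a].
  by rewrite eU (eqP (fU x)).
by rewrite eU (eqmxMr _ (eU _)).
Qed.

Lemma rep_of_entries (x : rep_index V -> K) : exists v : rep V, rep_entry v = x.
Proof.
exists (fun a => passmx.hommx (e (src a)) (e (tgt a)) (@of_entries _ _
  (fun a => dimV (src a)) (fun a => dimV (tgt a)) x a)).
rewrite -[LHS](@of_entriesK _ _ (fun a => dimV (src a)) (fun a => dimV (tgt a))).
rewrite -[RHS](@of_entriesK _ _ (fun a => dimV (src a)) (fun a => dimV (tgt a))).
congr entries_of; apply: functional_extensionality_dep => a.
by rewrite [LHS]mrep_of_repE passmx.hommxK //; apply: vbasisP.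
Qed.

End Coordinates.

Section Transfer.
Variables (K : fieldType) (Q : quiver).
Implicit Types b n : dimvec Q.

Lemma schofield_le_always b n :
  schofield_le K b n <-> always_subrep K (fun x => b x) (fun x => n x).
Proof.
split=> [[bn H]|[bn H]]; split=> //.
  pose V x := 'rV[K]_(n x) : vectType K.
  have dV : has_dimvec V n by move=> x; rewrite dimvf /dim /= mul1n.
  have nE : (fun x => n x) = (fun x => \dim {: V x}) by apply: funext.
  rewrite nE => v; have [v' Hv'] := rep_of_entries (entries_of v).
  have /quiver_Gr_subrep := H V dV v'.
  by rewrite /mrep_of_rep Hv' /mrep_of entries_ofK.
move=> V dV v; apply/quiver_Gr_subrep.
have nE : (fun x => n x) = (fun x => \dim {: V x}) by apply: funext => x; rewrite dV.
by move: H; rewrite nE; apply.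
Qed.

Let mpoly_ring m : nzRingType := mpoly.mpoly_mpoly__canonical__GRing_NzRing m K.

Lemma polyfun_mpoly (I : finType) (f : (I -> K) -> K) : polyfun f ->
  exists p : mpoly.mpoly #|I| K, forall x, f x = mpoly.meval (fun k => x (enum_val k)) p.
Proof.
elim=> [c|i|g h _ [p Hp] _ [q Hq]|g h _ [p Hp] _ [q Hq]].
- by exists (mpoly.mpolyC _ c) => x; rewrite mpoly.mevalC.
- exists (mpoly.mpolyX _ (mpoly.mnm1 (enum_rank i))) => x.
  by rewrite mpoly.mevalXU enum_rankK.
- by exists ((p : mpoly_ring _) + q) => x; rewrite mpoly.mevalD Hp Hq.
- by exists ((p : mpoly_ring _) * q) => x; rewrite mpoly.mevalM Hp Hq.
Qed.

Lemma mpoly_polyfun (I : finType) (p : mpoly.mpoly #|I| K) :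
  polyfun (fun x : I -> K => mpoly.meval (fun k => x (enum_val k)) p).
Proof.
elim/mpoly.mpolyind: p => [|c m p _ _ IH].
  by apply: eq_polyfun (polyfun_const I 0) => x; rewrite mpoly.meval0.
have pm : polyfun (fun x : I -> K => c * \prod_i x (enum_val i) ^+ mpoly.fun_of_multinom m i).
  apply: polyfun_mul; first exact: polyfun_const.
  apply: polyfun_prod => i _; elim: (mpoly.fun_of_multinom m i) => [|k IHk].
    exact: polyfun_const.
  apply: eq_polyfun (polyfun_mul (polyfun_coord K (enum_val i)) IHk) => x.
  by rewrite exprS.
apply: eq_polyfun (polyfun_add pm IH) => x.
by rewrite mpoly.mevalD mpoly.mevalZ mpoly.mevalX.
Qed.

End Transfer.

(** * Extremal subrepresentations *)

Section Extremal.
Variables (K : numClosedFieldType) (Q : quiver).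
Hypothesis closedK : subreps_specialize K.
Implicit Types b c d n : vertex Q -> nat.

Definition stable n (u : mrep K n) (m : vertex Q -> nat) (T : forall x, 'M[K]_(m x, n x)) :=
  forall a, (T (src a) *m u a <= T (tgt a))%MS.

Definition unique_subrep b n (u : mrep K n) := forall T T' : forall x, 'M[K]_(n x),
  (forall x, \rank (T x) = b x) -> stable u T ->
  (forall x, \rank (T' x) = b x) -> stable u T' -> forall x, (T x == T' x)%MS.

Lemma nonzero_hom b d (v : mrep K b) (w : mrep K d) :
  (arrow_form b d < vertex_form b d)%N ->
  exists phi, (forall a, hom_diff v w phi a = 0) /\ exists x, phi x != 0.
Proof.
move=> lt_forms.
have : kermx (hom_mx v w) != 0.
  rewrite -mxrank_eq0 mxrank_ker subn_eq0 -ltnNge.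
  apply: leq_ltn_trans (rank_leq_col _) _.
  by have := card_arrow_entries b d; have := card_vertex_entries b d; lia.
case/rowV0Pn => r /sub_kermxP rD r0.
pose phi := of_entries (unflat r) : forall x, 'M[K]_(b x, d x).
have phiE : flat (entries_of phi) = r by rewrite /phi of_entriesK unflatK.
exists phi; split; first by apply/hom_mxP; rewrite phiE.
apply: contrapT => phi0; move/eqP: r0; apply; rewrite -phiE; apply/flat_eq0 => x.
by apply/eqP; apply: contrapT => /negP nz; apply: phi0; exists x.
Qed.

(* For phi : S -> u / S, take the kernel of phi and the preimage of its image. *)
Lemma hom_to_quotient b d n (u : mrep K n) : n = (fun x => b x + d x)%N ->
  has_subrep b u -> (arrow_form b d < vertex_form b d)%N ->
  exists e (T1 : forall x, 'M[K]_(b x, n x)) (T2 : forall x, 'M[K]_(b x + b x, n x)),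
  [/\ stable u T1, stable u T2, forall x, (\rank (T1 x) + e x)%N = b x,
      forall x, \rank (T2 x) = (b x + e x)%N & exists x, (0 < e x)%N].
Proof.
move=> nE; subst n => -[U [fU uU]] /nonzero_hom nz.
have [s /pi_choice[k Hk]] := pi_choice (fun x => frameP (fU x)).
have [v1 [v2 [v3 [v4 Hu]]]] := block_rep_exists s k u.
have v20 a : v2 a = 0.
  apply: (@frame_stable _ _ _ _ s k v1 v2 v3 v4 a).
  by rewrite -Hu -(Hk (tgt a)) -(eqmxMr _ (Hk (src a))).
have [phi [/hom_diff_eq Hphi [x0 phi0]]] := nz v1 v4.
pose F x := frame (k x) (s x).
have fF x : row_free (F x) by apply/row_freeP; exists (coframe (k x) (s x)); apply: frameK.
have Fu a : F (src a) *m u a = block_mx (v1 a) 0 (v3 a) (v4 a) *m F (tgt a).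
  by rewrite Hu /block_rep !mulmxA frameK mul1mx v20.
exists (fun x => \rank (phi x)), (fun x => row_mx (kermx (phi x)) 0 *m F x),
  (fun x => block_mx 1%:M 0 0 (phi x) *m F x); split=> [a|a|x|x|].
- rewrite -mulmxA Fu mulmxA; apply: submxMr.
  rewrite mul_row_block !mul0mx !addr0 mulmx0.
  have /submxP[X ->] : (kermx (phi (src a)) *m v1 a <= kermx (phi (tgt a)))%MS.
    by apply/sub_kermxP; rewrite -mulmxA Hphi mulmxA mulmx_ker mul0mx.
  by apply/submxP; exists X; rewrite mul_mx_row mulmx0.
- rewrite -mulmxA Fu mulmxA; apply: submxMr.
  apply/submxP; exists (block_mx (v1 a) 0 (phi (src a) *m v3 a) (v1 a)).
  rewrite !mulmx_block !mul1mx !mulmx1 !mul0mx !mulmx0 !addr0 !add0r.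
  by rewrite Hphi.
- by rewrite mxrankMfree // rank_row_mx0 mxrank_ker subnK // rank_leq_row.
- by rewrite mxrankMfree // rank_diag_block_mx mxrank1.
- by exists x0; rewrite lt0n mxrank_eq0.
Qed.

(** Both conclusions rest on one exchange: if two subrepresentations of a generic u have dimension
    vectors adding up to b + b, then f is at least f b on each and sums to twice f b, so both are
    minimizers. Applied to the kernel and the preimage of the image of a nonzero T -> u / T, it
    gives a larger minimizer, a contradiction; applied to the intersection and the sum of two
    subrepresentations of dimension b, it gives that the sum is no larger than either. *)
Lemma extremal_subrep n c b0 : always_subrep K b0 n ->
  (vertex_form b0 c < arrow_form b0 c)%N ->
  exists b, [/\ always_subrep K b n, (vertex_form b c < arrow_form b c)%N,
    (vertex_form b (fun x => n x - b x)%N <= arrow_form b (fun x => n x - b x)%N)%N &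
    thin (fun x : arrow_entries n n -> K => ~ unique_subrep b (mrep_of x))].
Proof.
move=> ab0 neg0; pose M := (\sum_x n x)%N.
pose th b : int := (vertex_form b c)%:Z - (arrow_form b c)%:Z.
pose sz b := (\sum_x b x)%N.
(* Minimizing f selects, among the minimizers of th, those of largest total dimension. *)
pose f b : int := th b * M.+1%:Z - (sz b)%:Z.
have fD b1 b2 b3 b4 : (forall x, (b1 x + b2 x = b3 x + b4 x)%N) -> f b1 + f b2 = f b3 + f b4.
  move=> E.
  have Es : (sz b1 + sz b2 = sz b3 + sz b4)%N.
    by rewrite /sz -!big_split /=; apply: eq_bigr => x _.
  have Ev : (vertex_form b1 c + vertex_form b2 c = vertex_form b3 c + vertex_form b4 c)%N.
    by rewrite -!vertex_formDl; apply: eq_bigr => x _; rewrite E.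
  have Ea : (arrow_form b1 c + arrow_form b2 c = arrow_form b3 c + arrow_form b4 c)%N.
    by rewrite -!arrow_formDl; apply: eq_bigr => x _; rewrite E.
  have -> : f b1 + f b2 = (th b1 + th b2) * M.+1%:Z - (sz b1 + sz b2)%N%:Z.
    by rewrite /f PoszD; ring.
  have -> : f b3 + f b4 = (th b3 + th b4) * M.+1%:Z - (sz b3 + sz b4)%N%:Z.
    by rewrite /f PoszD; ring.
  by congr (_ * _ - _%:Z) => //; rewrite /th; lia.
(* Total dimensions are at most M, too small to offset a nonzero multiple of M + 1; so equal values
   of f on nested dimension vectors force equal [th] and equal size. *)
have multiple_eq0 (D : int) (k : nat) : D * M.+1%:Z = k%:Z -> (k <= M)%N -> k = 0%N.
  case: D => [[|D]|D]; first by rewrite mul0r => -[].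
    by rewrite -PoszM => -[<-]; rewrite mulSn; lia.
  by rewrite NegzE mulNr -PoszM; lia.
pose T : finType := {dffun forall x : vertex Q, 'I_(n x).+1}.
pose of_T (b : T) : vertex Q -> nat := fun x => b x.
have T_of b : (forall x, (b x <= n x)%N) -> of_T [ffun x => inord (b x)] = b.
  by move=> bn; apply: funext => x; rewrite /of_T ffunE inordK ?ltnS.
pose P (b : T) := `[< always_subrep K (of_T b) n >].
pose t0 : T := [ffun x => inord (b0 x)].
have Pt0 : P t0 by apply/asboolP; rewrite T_of //; apply: ab0.1.
have [t /asboolP at_ mint] := arg_minP (fun t => f (of_T t)) Pt0.
pose b := of_T t.
have minb b' : always_subrep K b' n -> f b <= f b'.
  move=> ab'; rewrite -(T_of b' ab'.1); apply: mint.
  by apply/asboolP; rewrite T_of //; apply: ab'.1.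
have f_inj b2 : (forall x, (b x <= b2 x)%N) -> (forall x, (b2 x <= n x)%N) -> f b2 = f b -> b2 = b.
  move=> bb2 b2n fE.
  have le_sz : (sz b <= sz b2)%N by apply: leq_sum.
  have le_M : (sz b2 <= M)%N by apply: leq_sum.
  have szE : sz b2 = sz b.
    have := multiple_eq0 (th b2 - th b) (sz b2 - sz b)%N.
    by rewrite mulrBl; move: fE; rewrite /f; lia.
  apply: funext => x; apply/eqP; rewrite eqn_leq bb2 andbT.
  move: szE; rewrite /sz (bigD1 x) //= [RHS](bigD1 x) //= => E.
  have : (\sum_(i | i != x) b i <= \sum_(i | i != x) b2 i)%N by apply: leq_sum.
  by move: E; lia.
have stable_f (u : mrep K n) m (S : forall x, 'M[K]_(m x, n x)) :
    ~ (exists b, has_subrep b u /\ ~ always_subrep K b n) -> stable u S ->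
    f b <= f (fun x => \rank (S x)).
  move=> good uS; apply: minb; apply: contrapT => nS; apply: good.
  exists (fun x => \rank (S x)); split=> //; exact: (has_subrep_rank (fun x => erefl)).
exists b; split=> //.
(* As [th b0] is at most -1, f b <= f b0 gives th b * (M + 1) <= -(M + 1) + M < 0. *)
- have := minb b0 ab0; have : (sz b <= M)%N by apply: leq_sum => x _; apply: at_.1.
  by rewrite /f /th; nia.
- rewrite leqNgt; apply/negP => lt_forms; pose d x := (n x - b x)%N.
  (* The inequality is purely numerical, so a single representation without exceptional
     subrepresentations suffices to refute its failure. *)
  have [u0 good] := not_thin_setT (generic_subreps closedK n).
  have nE : n = (fun x => b x + d x)%N by apply: funext => x; rewrite subnKC // at_.1.
  have ub := at_.2 (mrep_of u0).
  move: (mrep_of u0) good ub => u good ub.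
  have bn := at_.1; rewrite -/b in bn ub.
  have [e [T1 [T2 [s1 s2 r1 r2 [x0 e0]]]]] := hom_to_quotient nE ub lt_forms.
  have := f_inj (fun x => \rank (T2 x)).
  have f1 := stable_f _ _ _ good s1; have f2 := stable_f _ _ _ good s2.
  have E : f (fun x => \rank (T1 x)) + f (fun x => \rank (T2 x)) = f b + f b.
    by apply: fD => x; have := r1 x; have := r2 x; lia.
  move=> r2b; have /(congr1 (@^~ x0)) : (fun x => \rank (T2 x)) = b.
    by apply: r2b => [x|x|]; [rewrite r2 leq_addr|exact: rank_leq_col|lia].
  by rewrite /= r2; lia.
apply: thin_sub (generic_subreps closedK n) => u0 nu; apply: contrapT => good; apply: nu.
move: (mrep_of u0) good => u good S S' rS uS rS' uS'.
have uA : stable u (fun x => S x + S' x)%MS.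
  by move=> a; rewrite addsmxMr; apply: addsmxS; [apply: uS|apply: uS'].
have uI : stable u (fun x => S x :&: S' x)%MS.
  move=> a; rewrite sub_capmx; apply/andP; split.
    by apply: submx_trans (uS a); apply: submxMr; apply: capmxSl.
  by apply: submx_trans (uS' a); apply: submxMr; apply: capmxSr.
have fA := stable_f _ _ _ good uA; have fI := stable_f _ _ _ good uI.
have E : f (fun x => \rank (S x + S' x)%MS) + f (fun x => \rank (S x :&: S' x)%MS) = f b + f b.
  by apply: fD => x; rewrite mxrank_sum_cap rS rS'.
have rA : (fun x => \rank (S x + S' x)%MS) = b.
  apply: f_inj => [x|x|]; [|exact: rank_leq_col|by lia].
  by rewrite -(rS x); apply: mxrankS; apply: addsmxSl.
move=> x; have rx := congr1 (@^~ x) rA; rewrite /= in rx.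
have /eqmxP eS : (S x == S x + S' x)%MS.
  by rewrite -(geq_leqif (mxrank_leqif_eq (addsmxSl _ _))) rx rS.
have /eqmxP eS' : (S' x == S x + S' x)%MS.
  by rewrite -(geq_leqif (mxrank_leqif_eq (addsmxSr _ _))) rx rS'.
by apply/eqmxP; apply: eqmx_trans eS (eqmx_sym eS').
Qed.

End Extremal.

(** * The criterion *)

Section Main.
Variables (K : numClosedFieldType) (Q : quiver).
Hypothesis closedK : subreps_specialize K.
Implicit Types b n alpha : dimvec Q.

(** Generic uniqueness includes generic existence, which closedness extends to all representations.
    The necessity of (B) then is transitivity of <=_Q. *)
Lemma in_P_always alpha b : in_P K alpha b ->
  always_subrep K (fun x => b x) (fun x => alpha x).
Proof.
move=> [ba H]; split=> //.
pose A x := 'rV[K]_(alpha x) : vectType K.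
have dA : has_dimvec A alpha by move=> x; rewrite dimvf /dim /= mul1n.
have aE : (fun x => alpha x) = (fun x => \dim {: A x}) by apply: funext.
rewrite aE; apply: closedK.
have [U [[F HF] [v0 /HF[p Fp pv0]] UP]] := H A dA.
exists (fun x => mpoly.meval (fun k => x (enum_val k)) p); split.
- exact: mpoly_polyfun.
- by exists (rep_entry v0).
move=> x nx; have [v Hv] := rep_of_entries x.
apply/eqP; apply: contrapT => /negP px; apply: nx.
have /UP[S [HS _]] : U v by apply/HF; exists p => //; rewrite /rep_eval Hv.
have /quiver_Gr_subrep : exists S, quiver_Gr b v S by exists S.
by rewrite /mrep_of_rep Hv.
Qed.

Lemma in_P_of_generic alpha b : always_subrep K (fun x => b x) (fun x => alpha x) ->
  thin (fun x : arrow_entries (fun x => alpha x) (fun x => alpha x) -> K =>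
    ~ unique_subrep (fun x => b x) (mrep_of x)) ->
  in_P K alpha b.
Proof.
move=> ab tb; split=> [|A dA]; first exact: ab.1.
have aE : (fun x => alpha x) = (fun x => \dim {: A x}) by apply: funext => x; rewrite dA.
move: ab tb; rewrite aE => ab [f [/polyfun_mpoly[p Hp] [x0 fx0] fX]].
exists (fun v => rep_eval p v != 0); split.
- by exists (eq p) => v; split=> [pv|[_ <-]] //; exists p.
- by have [v0 Hv] := rep_of_entries x0; exists v0; rewrite /rep_eval Hv -Hp.
move=> v pv; have /quiver_Gr_subrep[S HS] := ab.2 (mrep_of_rep v).
exists S; split=> // S' HS' x.
have uniq : unique_subrep (fun x => b x) (mrep_of_rep v).
  by apply: contrapT => /fX; rewrite Hp; apply/eqP.
have /quiver_Gr_msof[dS uS] := HS; have /quiver_Gr_msof[dS' uS'] := HS'.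
have /andP[le1 le2] := uniq _ _ dS uS dS' uS' x.
by apply/eqP; rewrite eqEsubv -!(passmx.sub_msof (vbasisP {: A x})) le1 le2.
Qed.

Lemma schofield_criterion n alpha : dimvec_le alpha n ->
  schofield_le K alpha n <->
  (0 <= euler_form alpha (dimvec_sub n alpha) /\
   forall b, in_P K alpha b -> b <> alpha -> schofield_le K b n).
Proof.
move=> an; pose c x := (n x - alpha x)%N.
have nE : (fun x => n x) = (fun x => alpha x + c x)%N.
  by apply: funext => x; rewrite subnKC.
have eulerE : euler_form alpha (dimvec_sub n alpha) =
    (vertex_form (fun x => alpha x) c)%:Z - (arrow_form (fun x => alpha x) c)%:Z.
  rewrite /euler_form /vertex_form /arrow_form !(big_morph Posz PoszD (erefl 0)).
  by congr (_ - _); apply: eq_bigr => x _; rewrite ffunE PoszM.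
split=> [/schofield_le_always sub|[euler_ge0 HP]].
  split=> [|b /in_P_always ab _].
    by rewrite eulerE subr_ge0 lez_nat; apply: (@always_subrep_forms _ K); rewrite -nE.
  by apply/schofield_le_always; apply: always_subrep_trans ab sub.
apply/schofield_le_always; rewrite nE; apply: contrapT => nsub.
have [|b0 [ab0 neg0]] := @subrep_of_nonfull K Q closedK (fun x => alpha x) c.
  by move=> u w; apply/negP => /(hom_mx_full_always closedK).
have [b [ab neg le_forms uniq]] := extremal_subrep closedK ab0 neg0.
pose b' : dimvec Q := [ffun x => b x].
have bE : (fun x => b' x) = b by apply: funext => x; rewrite ffunE.
have inP : in_P K alpha b' by apply: in_P_of_generic; rewrite bE.
have [ba|ba] := eqVneq b' alpha.
  by move: euler_ge0; rewrite eulerE -ba bE subr_ge0 lez_nat leqNgt neg.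
have /schofield_le_always := HP b' inP (elimN eqP ba); rewrite bE nE.
have -> : (fun x => alpha x + c x)%N = (fun x => b x + ((alpha x - b x) + c x))%N.
  by apply: funext => x; rewrite addnA subnKC //; apply: ab.1.
move=> /always_subrep_forms; rewrite vertex_formDr arrow_formDr.
lia.
Qed.

End Main.

Theorem theorem6p9 (R : realType) (Q : quiver) (n alpha : dimvec Q)
    (le_alpha_n : dimvec_le alpha n) :
  schofield_le (complex R) alpha n <->
  (0 <= euler_form alpha (dimvec_sub n alpha) /\
   forall beta : dimvec Q, in_P (complex R) alpha beta -> beta <> alpha ->
     schofield_le (complex R) beta n).
Proof.
by apply: schofield_criterion => // Q' b m; apply: has_subrep_closed.
Qed.
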